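(* Consider the sparse PCA setting described in the context, and suppose that as $n\to\infty$: (1) $s\log(p)\ll n$, $k\ll s$, and $n\lesssim p$; (2) (sparsistency) with probability at least $1-\delta$ the support $\hat J$ selected by the sparse PCA algorithm is the correct set, i.e. $\hat J=J$; (3) the $X_i$ are mean zero and satisfy $X_i=\Sigma^{1/2}Y_i$, where $Y_1,\dots,Y_n\in\mathbb{R}^p$ are independent, mean zero, with independent coordinates of unit variance, and the $\psi_2$ norm of each coordinate satisfies $\|Y_{ij}\|_{\psi_2}=1$; (4) $C\lambda_1\Big(\sqrt{\tfrac{s}{n}}+\sqrt{\tfrac{\log(p)}{n}}\Big)+\tfrac{\lambda_{k+1}}{8}\le\tfrac{\lambda_k}{8}$ for some sufficiently large constant $C$, and for all $p$, $2\lambda_{k+1}<(1-\varepsilon)\lambda_k$ for some $\varepsilon>\tfrac1{64}$; (5) $\|U\|_{2\to\infty}\lesssim (k/s)^{1/2}$, $k\lesssim\sqrt{s}$, and $\lambda_{k+1}\le\tfrac{\lambda}{2}<\lambda\le\lambda_k\le\lambda_1\le\kappa\lambda$ for some parameters $\kappa$ and $\lambda$. Let $\tilde U\in\mathbb{R}^{p\times k}$ be the output of the refitting procedure described in the context. Then with probability at least $1-\delta-p^{-2}$ there exists an orthogonal matrix $W_*\in\mathbb{O}(k)$ such that $$\max_{1\le i\le p}\|\tilde U_{i\cdot}-(UW_* )_{i\cdot}\|\lesssim \kappa^2\sqrt{\frac{k\log(p)}{n}}+\kappa^3\frac{s\log(p)}{n}.$$ Consequently, if $\kappa=O(1)$,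 then $$\max_{1\le i\le p}\|\tilde U_{i\cdot}-(UW_* )_{i\cdot}\|\lesssim \sqrt{\frac{k\log(p)}{n}}+\frac{s\log(p)}{n}.$$
   Context: Asymptotic conventions: everything is indexed by the sample size $n\to\infty$; the positive integers $p,s,k$, the matrix $\Sigma$, the parameters $\kappa,\lambda$ and $\delta$ may depend on $n$. $f\lesssim g$ (or $f=O(g)$) means there is a constant $C'$ with $f(n)\le C'g(n)$ for all sufficiently large $n$; $f\ll g$ means $f/g\to0$. Norms: $\|X\|_{\psi_2}=\inf\{t>0:\mathbb{E}\exp(X^2/t^2)\le 2\}$ is the Orlicz norm of order 2 (subgaussian norm) of a real random variable $X$. $\|\cdot\|$ is the Euclidean norm of vectors and the spectral norm of matrices; $\|M\|_{2\to\infty}=\max_i\|M_{i\cdot}\|$ is the maximum Euclidean row norm, where $M_{i\cdot}$ is the $i$-th row. $\mathbb{O}(k)$ is the set of $k\times k$ orthogonal matrices. Setting: $X_1,\dots,X_n\in\mathbb{R}^p$ are mean-zero with covariance matrix $\Sigma$, whose eigenvalues are $\lambda_1\ge\cdots\ge\lambda_p\ge0$, with $\lambda_k>\lambda_{k+1}$. $U\in\mathbb{R}^{p\times k}$ is a matrix of orthonormal eigenvectors for $\lambda_1,\dots,\lambda_k$. There is a set $J\subset\{1,\dots,p\}$ with $|J|\le s$ such that all rows of $U$ with index outside $J$ are zero. $\hat\Sigma=\frac1n\sum_{i=1}^nX_iX_i^\top$. $M_{JJ}$ denotes the principal submatrix of $M$ with rows and columns in $J$. Procedure: a sparse PCA algorithm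 (any algorithm satisfying (2)) run on $\hat\Sigma$ returns a support estimate $\hat J\subset\{1,\dots,p\}$. Let $\tilde U_{\hat J}$ be a matrix whose columns are $k$ orthonormal leading eigenvectors of $\hat\Sigma_{\hat J\hat J}$, with rows indexed by $\hat J$. The output $\tilde U\in\mathbb{R}^{p\times k}$ has rows $\tilde U_{i\cdot}=(\tilde U_{\hat J})_{i\cdot}$ for $i\in\hat J$ and $\tilde U_{i\cdot}=0$ for $i\notin\hat J$. In (5) the parameter $\kappa$ is the reduced condition number $\lambda_1/\lambda_k$ (one may take $\lambda=\lambda_k$, $\kappa=\lambda_1/\lambda_k$).
   Formalization: Unit variance forces the ψ2 norm of each coordinate to exceed 1, so hypothesis (3) as printed is inconsistent; the formal statement takes ‖Y_ij‖_{ψ2}=K for an arbitrary fixed constant K, with the threshold for C in (4) allowed to depend on K. *)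

(* Defs.v *)
From HB Require Import structures.
From mathcomp Require Import all_boot all_order all_algebra.
From mathcomp Require Import all_classical all_reals all_analysis.

Set Implicit Arguments.
Unset Strict Implicit.
Unset Printing Implicit Defensive.

Import Order.TTheory GRing.Theory Num.Theory.
Import numFieldNormedType.Exports.

Local Open Scope classical_set_scope.
Local Open Scope ring_scope.

Definition lesssim (R : realType) (f g : nat -> R) : Prop :=
  exists C : R, \forall n \near \oo, f n <= C * g n.

Definition much_less (R : realType) (f g : nat -> R) : Prop :=
  (fun n => f n / g n) @ \oo --> (0 : R).

(* The norm of MathComp-Analysis on matrices is the sup norm, so the Euclidean
   norm of a row vector has its own definition. *)
Definition norm2 (R : realType) (m : nat) (v : 'rV[R]_m) : R :=
  Num.sqrt (\sum_(j < m) v 0 j ^+ 2).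

Definition norm2inf (R : realType) (m k : nat) (M : 'M[R]_(m, k)) : R :=
  \big[Num.max/0]_(i < m) norm2 (row i M).

Definition orthonormal_cols (R : realType) (m k : nat) (V : 'M[R]_(m, k)) :
  Prop := V^T *m V = 1%:M.

Definition orthogonal_mx (R : realType) (k : nat) (W : 'M[R]_k) : Prop :=
  W^T *m W = 1%:M /\ W *m W^T = 1%:M.

Definition psd (R : realType) (m : nat) (M : 'M[R]_m) : Prop :=
  M^T = M /\ forall v : 'rV[R]_m, 0 <= (v *m M *m v^T) 0 0.

Definition is_psd_sqrt (R : realType) (m : nat) (A M : 'M[R]_m) : Prop :=
  psd A /\ A *m A = M.

(* [l] lists the eigenvalues of [M] with multiplicity, in nonincreasing order;
   the factorization of the characteristic polynomial forces [size l = m]. *)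
Definition ordered_eigenvalues (R : realType) (m : nat) (M : 'M[R]_m)
    (l : seq R) : Prop :=
  sorted (fun x y => y <= x) l /\ char_poly M = \prod_(x <- l) ('X - x%:P).

(* One-based: [eigval l j] is the j-th largest eigenvalue. *)
Definition eigval (R : realType) (l : seq R) (j : nat) : R := nth 0 l j.-1.

Definition leading_eigenvectors (R : realType) (m k : nat) (M : 'M[R]_m)
    (l : seq R) (V : 'M[R]_(m, k)) : Prop :=
  orthonormal_cols V /\ M *m V = V *m diag_mx (\row_(j < k) eigval l j.+1).

Definition principal_submx (R : realType) (m : nat) (M : 'M[R]_m)
    (J : {set 'I_m}) : 'M[R]_(#|J|) :=
  \matrix_(a, b) M (enum_val a) (enum_val b).

Definition sample_covariance (R : realType) (n m : nat)
    (x : 'I_n -> 'cV[R]_m) : 'M[R]_m :=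
  n%:R^-1 *: \sum_(i < n) x i *m (x i)^T.

(* The eigenvectors need not be unique (signs, ties), so refitting is a
   relation: any choice of k orthonormal leading eigenvectors is admitted. *)
Definition refit (R : realType) (m k : nat) (S : 'M[R]_m) (J : {set 'I_m})
    (Ut : 'M[R]_(m, k)) : Prop :=
  (exists (l : seq R) (V : 'M[R]_(#|J|, k)),
     [/\ ordered_eigenvalues (principal_submx S J) l,
         leading_eigenvectors (principal_submx S J) l V &
         forall a : 'I_#|J|, row (enum_val a) Ut = row a V]) /\
  (forall i, i \notin J -> row i Ut = 0).

(* Extended-real valued: the infimum over the empty set is +oo, whereas a
   real-valued infimum would give the junk value 0 to variables that are not
   subgaussian. Since exp(x^2) > 1 + x^2 for x <> 0, a variable of unit variance
   always has norm strictly greater than 1. *)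
Definition psi2_norm (R : realType) (d : measure_display)
    (T : measurableType d) (P : probability T R) (Z : T -> R) : \bar R :=
  ereal_inf [set t%:E | t in [set t : R | 0 < t /\
    ('E_P[fun w => expR (Z w ^+ 2 / t ^+ 2)] <= 2%:E)%E]].

Definition sigma_rv (R : realType) (d : measure_display)
    (T : measurableType d) (Z : T -> R) : set (set T) :=
  preimage_set_system setT Z measurable.

(* The sigma-algebra generated by a random vector with coordinates [Z j]. *)
Definition sigma_rvec (R : realType) (d : measure_display)
    (T : measurableType d) (m : nat) (Z : 'I_m -> T -> R) : set (set T) :=
  <<s \bigcup_(j in [set: 'I_m]) sigma_rv (Z j) >>.

(* For sigma-algebras the product rule over the whole finite family contains
   the rule for every subfamily: take [E i = setT] off the subfamily. *)
Definition independent_sigma (R : realType) (d : measure_display)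
    (T : measurableType d) (P : probability T R) (m : nat)
    (F : 'I_m -> set (set T)) : Prop :=
  forall E : 'I_m -> set T, (forall i, F i (E i)) ->
    P (\bigcap_(i in [set: 'I_m]) E i) = (\prod_(i < m) P (E i))%E.

(* Inner-measure form of "A holds with probability at least q"; it agrees with
   q <= P A when A is measurable and needs no measurability of A itself. *)
Definition with_prob_ge (R : realType) (d : measure_display)
    (T : measurableType d) (P : probability T R) (q : R) (A : set T) : Prop :=
  exists E : set T, [/\ measurable E, E `<=` A & (q%:E <= P E)%E].

(* The random estimate [Ut] recovers [U] up to rotation, row by row, within a
   constant multiple of [b n], with probability at least [q n] for large n; the
   constant depends neither on n nor on the sample point. *)
Definition rowwise_recovery (R : realType) (d : nat -> measure_display)
    (T : forall n, measurableType (d n)) (P : forall n, probability (T n) R)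
    (p k : nat -> nat) (q b : nat -> R)
    (U : forall n, 'M[R]_(p n, k n))
    (Ut : forall n, T n -> 'M[R]_(p n, k n)) : Prop :=
  exists C : R, \forall n \near \oo,
    with_prob_ge (P n) (q n)
      [set w | exists W : 'M[R]_(k n), orthogonal_mx W /\
         norm2inf (Ut n w - U n *m W) <= C * b n].

(* Main.v *)
(** Splitting the refitted eigenvectors as [V = U A + B] along the true ones, the
    part [B] solves a Sylvester equation whose first-order solution has entries of
    the form [a^T (Shat - Sigma) u] with [a] and [u] deterministic; each of them is
    of order [lambda_1 sqrt(log p / n)] by a scalar Bernstein bound, and the
    remainder is quadratic in [|Shat - Sigma| / lambda_k] in operator norm. The
    factor [A] is within [|B|^2] of its orthogonal polar factor, which is the
    rotation sought.

    A crude integer grid net gives [|Shat_JJ - Sigma_JJ| = O(lambda_1 r)] with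
    [r^2 = s log p / n]. This loses a logarithm on the sharp bound, but it is
    enough: when [kappa r] is not small the right-hand side of the claim is bounded
    below and the claim is trivial, rows of matrices with orthonormal columns
    having norm at most 1. *)

(* Sparsistency removes the only data-dependent choice: on the event [Jhat = J] all test vectors
   live on the fixed set [J], so concentration reduces to one scalar tail bound and a union bound
   over two finite families. These are run at different scales. The net on [J] has at most
   [p ^ (2 s)] points and forces a relative deviation of order [sqrt (s log p / n)], which is
   affordable because the operator norm enters the final bound only squared. The vectors for the
   entries number at most [2 p ^ 2] and allow the smaller deviation [sqrt (log p / n)]; the factor
   [sqrt k] of the first term comes from the [k] entries of a row. With squared deviations equal to
   [24 * rate_const] times the respective rates, the tails are [2 p ^ (- 6 s)] and [2 p ^ (- 6)],
   which leaves each family a failure probability of at most [p ^ (- 2) / 2]. *)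
Require Import Defs.
From HB Require Import structures.
From mathcomp Require Import all_boot all_order all_algebra.
From mathcomp Require Import finmap.
From mathcomp Require Import all_classical all_reals all_analysis.
From mathcomp Require Import measurable_realfun.
From mathcomp Require Import ring lra zify.

Set Implicit Arguments.
Unset Strict Implicit.
Unset Printing Implicit Defensive.

Import Order.TTheory GRing.Theory Num.Theory.
Import numFieldNormedType.Exports.

Local Open Scope classical_set_scope.
Local Open Scope ring_scope.

(** * Bilinear forms and operator bounds *)

Section BilinearForms.
Variable R : realType.

Definition dotv m (u v : 'rV[R]_m) : R := (u *m v^T) 0 0.

Definition bform m n (M : 'M[R]_(m, n)) (u : 'rV[R]_m) (v : 'rV[R]_n) : R :=
  (u *m M *m v^T) 0 0.

Lemma dotvE m (u v : 'rV[R]_m) : dotv u v = \sum_(j < m) u 0 j * v 0 j.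
Proof. by rewrite /dotv mxE; apply: eq_bigr => j _; rewrite mxE. Qed.

Lemma dotvC m (u v : 'rV[R]_m) : dotv u v = dotv v u.
Proof. by rewrite !dotvE; apply: eq_bigr => j _; rewrite mulrC. Qed.

Lemma dotvDl m (u v w : 'rV[R]_m) : dotv (u + v) w = dotv u w + dotv v w.
Proof. by rewrite /dotv mulmxDl mxE. Qed.

Lemma dotvZl m a (u w : 'rV[R]_m) : dotv (a *: u) w = a * dotv u w.
Proof. by rewrite /dotv -scalemxAl mxE. Qed.

Lemma dotvDr m (u v w : 'rV[R]_m) : dotv u (v + w) = dotv u v + dotv u w.
Proof. by rewrite dotvC dotvDl ![dotv _ u]dotvC. Qed.

Lemma dotvZr m a (u w : 'rV[R]_m) : dotv u (a *: w) = a * dotv u w.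
Proof. by rewrite dotvC dotvZl dotvC. Qed.

Lemma bform_dotl m n (M : 'M[R]_(m, n)) u v : bform M u v = dotv (u *m M) v.
Proof. by []. Qed.

Lemma bform_dotr m n (M : 'M[R]_(m, n)) u v :
  bform M u v = dotv u (v *m M^T).
Proof. by rewrite /bform /dotv trmx_mul trmxK mulmxA. Qed.

Lemma bform1 m (u v : 'rV[R]_m) : bform 1%:M u v = dotv u v.
Proof. by rewrite /bform mulmx1. Qed.

Lemma bform_tr m n (M : 'M[R]_(m, n)) u v : bform M^T v u = bform M u v.
Proof. by rewrite bform_dotl bform_dotr dotvC. Qed.

Lemma bform_sym m (M : 'M[R]_m) u v : M^T = M -> bform M v u = bform M u v.
Proof. by move=> sM; rewrite -{1}sM bform_tr. Qed.

Lemma bformDl m n (M : 'M[R]_(m, n)) u1 u2 v :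
  bform M (u1 + u2) v = bform M u1 v + bform M u2 v.
Proof. by rewrite !bform_dotl mulmxDl dotvDl. Qed.

Lemma bformZl m n (M : 'M[R]_(m, n)) a u v :
  bform M (a *: u) v = a * bform M u v.
Proof. by rewrite !bform_dotl -scalemxAl dotvZl. Qed.

Lemma bformDr m n (M : 'M[R]_(m, n)) u v1 v2 :
  bform M u (v1 + v2) = bform M u v1 + bform M u v2.
Proof. by rewrite !bform_dotl dotvDr. Qed.

Lemma bformZr m n (M : 'M[R]_(m, n)) a u v :
  bform M u (a *: v) = a * bform M u v.
Proof. by rewrite !bform_dotl dotvZr. Qed.

Lemma bformD m n (M N : 'M[R]_(m, n)) u v :
  bform (M + N) u v = bform M u v + bform N u v.
Proof. by rewrite !bform_dotl mulmxDr dotvDl. Qed.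

Lemma bformN m n (M : 'M[R]_(m, n)) u v : bform (- M) u v = - bform M u v.
Proof. by rewrite /bform mulmxN mulNmx mxE. Qed.

Lemma bform_scalar m a (u v : 'rV[R]_m) : bform a%:M u v = a * dotv u v.
Proof. by rewrite bform_dotl mul_mx_scalar dotvZl. Qed.

Lemma bform_mul m n m' n' (A : 'M[R]_(m', m)) (M : 'M[R]_(m, n))
    (B : 'M[R]_(n', n)) u v :
  bform (A *m M *m B^T) u v = bform M (u *m A) (v *m B).
Proof. by rewrite /bform trmx_mul !mulmxA. Qed.

Lemma bform_polar m (M : 'M[R]_m) (u v : 'rV[R]_m) : M^T = M ->
  4%:R * bform M u v = bform M (u + v) (u + v) - bform M (u - v) (u - v).
Proof.
move=> sM; rewrite -[- v]scaleN1r !(bformDl, bformDr, bformZl, bformZr).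
by rewrite (bform_sym u v sM); ring.
Qed.

Lemma norm2_ge0 m (u : 'rV[R]_m) : 0 <= norm2 u.
Proof. exact: sqrtr_ge0. Qed.

Lemma sqr_norm2 m (u : 'rV[R]_m) : norm2 u ^+ 2 = dotv u u.
Proof.
by rewrite sqr_sqrtr ?dotvE ?sumr_ge0// => j _; rewrite sqr_ge0.
Qed.

Lemma dotv_ge0 m (u : 'rV[R]_m) : 0 <= dotv u u.
Proof. by rewrite -sqr_norm2 sqr_ge0. Qed.

Lemma norm2_eq0 m (u : 'rV[R]_m) : norm2 u = 0 -> u = 0.
Proof.
move=> /(congr1 (fun x => x ^+ 2)); rewrite sqr_norm2 expr0n/= dotvE => /eqP.
rewrite psumr_eq0 => [/allP h|j _]; last by rewrite -expr2 sqr_ge0.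
apply/rowP => j; rewrite mxE.
by have /h := mem_index_enum j; rewrite /= -expr2 sqrf_eq0 => /eqP.
Qed.

Lemma norm2_gt0 m (u : 'rV[R]_m) : u != 0 -> 0 < norm2 u.
Proof.
by move=> u0; rewrite lt_def norm2_ge0 andbT; apply: contra u0 => /eqP/norm2_eq0->.
Qed.

Lemma norm20 m : norm2 (0 : 'rV[R]_m) = 0.
Proof.
by rewrite /norm2 big1 ?sqrtr0// => j _; rewrite mxE expr0n.
Qed.

Lemma psd_CauchySchwarz m (N : 'M[R]_m) (x y : 'rV[R]_m) :
  N^T = N -> (forall z, 0 <= bform N z z) ->
  bform N x y ^+ 2 <= bform N x x * bform N y y.
Proof.
move=> sN pN.
have h t : 0 <= bform N x x + 2 * t * bform N x y + t ^+ 2 * bform N y y.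
  have := pN (x + t *: y).
  rewrite !(bformDl, bformDr, bformZl, bformZr) (bform_sym x y sN).
  by congr (_ <= _); ring.
move: (pN y) h; set a := bform N x x; set b := bform N x y.
set c := bform N y y; rewrite le_eqVlt => /orP[/eqP <- h|c0 h].
  have [->|b0] := eqVneq b 0; first by rewrite expr0n/= mulr0.
  (* With [c = 0] the polynomial is affine in the parameter; at this value it equals [-1], so [b]
     must vanish. *)
  have := h (- (a + 1) / (2 * b)).
  have -> : 2 * (- (a + 1) / (2 * b)) * b = - (a + 1) by field.
  by rewrite mulr0; lra.
have := h (- b / c).
have -> : a + 2 * (- b / c) * b + (- b / c) ^+ 2 * c = (a * c - b ^+ 2) / c.
  by field; rewrite gt_eqF.
by rewrite pmulr_lge0 ?invr_gt0// subr_ge0.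
Qed.

Lemma CauchySchwarz m (u v : 'rV[R]_m) : `|dotv u v| <= norm2 u * norm2 v.
Proof.
rewrite -ler_sqr ?nnegrE ?mulr_ge0 ?norm2_ge0// exprMn !sqr_norm2 real_normK ?num_real//.
rewrite -!bform1; apply: psd_CauchySchwarz; first by rewrite trmx1.
by move=> z; rewrite bform1 dotv_ge0.
Qed.

Lemma ler_norm2D m (u v : 'rV[R]_m) : norm2 (u + v) <= norm2 u + norm2 v.
Proof.
rewrite -ler_sqr ?nnegrE ?addr_ge0 ?norm2_ge0// sqr_norm2 !(dotvDl, dotvDr).
rewrite -!sqr_norm2 (dotvC v u).
have := CauchySchwarz u v; have := ler_norm (dotv u v); nra.
Qed.

Lemma norm2Z m a (u : 'rV[R]_m) : norm2 (a *: u) = `|a| * norm2 u.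
Proof.
apply/eqP; rewrite -(@eqrXn2 _ 2) ?mulr_ge0 ?norm2_ge0//.
by rewrite exprMn !sqr_norm2 dotvZl dotvZr real_normK ?num_real// mulrA.
Qed.

Lemma norm2N m (u : 'rV[R]_m) : norm2 (- u) = norm2 u.
Proof. by rewrite -scaleN1r norm2Z normrN1 mul1r. Qed.

Lemma ler_norm2B m (u v : 'rV[R]_m) : norm2 (u - v) <= norm2 u + norm2 v.
Proof. by rewrite (le_trans (ler_norm2D _ _))// norm2N. Qed.

End BilinearForms.

(** * Upper bounds on operator norms *)

Section OperatorBounds.
Variable R : realType.

(** A predicate on upper bounds replaces the operator norm, since most arguments only propagate
    bounds. The clause [0 <= c] does not follow from the other one when [m = 0]. Acting on row
    vectors lets an operator bound control every row directly. *)
Definition opbound m n (M : 'M[R]_(m, n)) (c : R) : Prop :=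
  0 <= c /\ forall u, norm2 (u *m M) <= c * norm2 u.

Lemma opbound_bform m n (M : 'M[R]_(m, n)) c u v :
  opbound M c -> `|bform M u v| <= c * norm2 u * norm2 v.
Proof.
move=> [c0 h]; rewrite bform_dotl (le_trans (CauchySchwarz _ _))//.
by rewrite ler_wpM2r ?norm2_ge0.
Qed.

Lemma bform_opbound m n (M : 'M[R]_(m, n)) c : 0 <= c ->
  (forall u v, bform M u v <= c * norm2 u * norm2 v) -> opbound M c.
Proof.
move=> c0 h; split=> // u; have := h u (u *m M).
rewrite bform_dotl -sqr_norm2 expr2; have := norm2_ge0 (u *m M).
rewrite le_eqVlt => /orP[/eqP <- _|p]; first by rewrite mulr_ge0 ?norm2_ge0.
by rewrite ler_pM2r.
Qed.

Lemma opbound_tr m n (M : 'M[R]_(m, n)) c : opbound M c -> opbound M^T c.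
Proof.
move=> h; apply: bform_opbound; first by case: h.
move=> u v; rewrite bform_tr mulrAC.
exact: le_trans (ler_norm _) (opbound_bform _ _ h).
Qed.

Lemma opbound_le m n (M : 'M[R]_(m, n)) c d :
  c <= d -> opbound M c -> opbound M d.
Proof.
move=> cd [c0 h]; split=> [|u]; first exact: le_trans cd.
by rewrite (le_trans (h u))// ler_wpM2r ?norm2_ge0.
Qed.

Lemma opboundD m n (M N : 'M[R]_(m, n)) c d :
  opbound M c -> opbound N d -> opbound (M + N) (c + d).
Proof.
move=> [c0 hM] [d0 hN]; split=> [|u]; first exact: addr_ge0.
by rewrite mulmxDr (le_trans (ler_norm2D _ _))// mulrDl lerD.
Qed.

Lemma opboundN m n (M : 'M[R]_(m, n)) c : opbound M c -> opbound (- M) c.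
Proof. by move=> [c0 h]; split=> // u; rewrite mulmxN norm2N. Qed.

Lemma opboundB m n (M N : 'M[R]_(m, n)) c d :
  opbound M c -> opbound N d -> opbound (M - N) (c + d).
Proof. by move=> hM /opboundN; exact: opboundD. Qed.

Lemma opboundM m n k (M : 'M[R]_(m, n)) (N : 'M[R]_(n, k)) c d :
  opbound M c -> opbound N d -> opbound (M *m N) (c * d).
Proof.
move=> [c0 hM] [d0 hN]; split=> [|u]; first exact: mulr_ge0.
rewrite mulmxA (le_trans (hN _))// mulrAC [X in _ <= X]mulrC.
by rewrite ler_wpM2l// hM.
Qed.

Lemma norm2_delta m (i : 'I_m) : norm2 (delta_mx 0 i : 'rV[R]_m) = 1.
Proof.
rewrite /norm2 (bigD1 i)//= big1 ?addr0 ?mxE ?eqxx ?expr1n ?sqrtr1// => j ji.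
by rewrite mxE (negPf ji) andbF expr0n.
Qed.

Lemma opbound_row m n (M : 'M[R]_(m, n)) c i :
  opbound M c -> norm2 (row i M) <= c.
Proof. by move=> [_ /(_ (delta_mx 0 i))]; rewrite -rowE norm2_delta mulr1. Qed.

Lemma opbound_diag m (d : 'rV[R]_m) c : 0 <= c ->
  (forall j, `|d 0 j| <= c) -> opbound (diag_mx d) c.
Proof.
move=> c0 h; split=> // u.
rewrite -ler_sqr ?nnegrE ?mulr_ge0 ?norm2_ge0// exprMn !sqr_norm2 !dotvE mulr_sumr.
apply: ler_sum => j _; rewrite mul_mx_diag mxE -!expr2 exprMn mulrC.
rewrite ler_wpM2r ?sqr_ge0// -[X in X <= _]real_normK ?num_real//.
by rewrite ler_sqr ?nnegrE.
Qed.

Lemma isometry_norm2 m n (V : 'M[R]_(m, n)) (u : 'rV_m) : V *m V^T = 1%:M ->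
  norm2 (u *m V) = norm2 u.
Proof.
move=> VV; apply/eqP; rewrite -(@eqrXn2 _ 2) ?norm2_ge0// !sqr_norm2 /dotv.
by rewrite trmx_mul mulmxA -(mulmxA u) VV mulmx1.
Qed.

Lemma opbound_ortho m n (V : 'M[R]_(m, n)) : V^T *m V = 1%:M -> opbound V 1.
Proof.
move=> VV; rewrite -(trmxK V); apply: opbound_tr; split=> // u.
by rewrite isometry_norm2 ?mul1r// trmxK.
Qed.

Lemma opbound_ex m n (M : 'M[R]_(m, n)) : exists c, opbound M c.
Proof.
(* The Frobenius norm, by Cauchy-Schwarz on each column. *)
exists (Num.sqrt (\sum_(j < n) norm2 (col j M)^T ^+ 2)).
split=> [|u]; first exact: sqrtr_ge0.
rewrite -ler_sqr ?nnegrE ?mulr_ge0 ?norm2_ge0 ?sqrtr_ge0// exprMn.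
rewrite [X in _ <= X * _]sqr_sqrtr ?sumr_ge0// => [|j _]; last by rewrite sqr_ge0.
rewrite [X in X <= _]sqr_norm2 dotvE mulr_suml; apply: ler_sum => j _; rewrite -expr2.
have -> : (u *m M) 0 j = dotv u (col j M)^T.
  by rewrite dotvE mxE; apply: eq_bigr => i _; rewrite !mxE.
rewrite -exprMn -[X in X <= _]real_normK ?num_real// ler_sqr ?nnegrE//.
  by rewrite mulrC CauchySchwarz.
by rewrite mulr_ge0 ?norm2_ge0.
Qed.

(** The operator norm as a least bound. It serves self-improving arguments: an estimate that yields
    a new bound from [c] itself can be compared with the minimal [c] and solved for it. *)
Lemma opbound_min m n (M : 'M[R]_(m, n)) :
  exists c, opbound M c /\ forall d, opbound M d -> c <= d.
Proof.
pose A := [set c | opbound M c]; have lbA : lbound A 0 by move=> c [].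
have A0 : A !=set0 by have [c] := opbound_ex M; exists c.
exists (inf A); split=> [|d Ad]; last by apply: ge_inf => //; exists 0.
split=> [|u]; first exact: lb_le_inf.
have := norm2_ge0 u; rewrite le_eqVlt => /orP[/eqP u0|u0].
  by have [c [_ /(_ u)]] := A0; rewrite -u0 !mulr0.
rewrite -ler_pdivrMr//; apply: lb_le_inf => // c [_ /(_ u)].
by rewrite ler_pdivrMr.
Qed.

Lemma opbound_sym m (M : 'M[R]_m) c : M^T = M -> 0 <= c ->
  (forall x, `|bform M x x| <= c * norm2 x ^+ 2) -> opbound M c.
Proof.
move=> sM c0 h; apply: bform_opbound => // u v.
(* Polarization and the parallelogram law: [4 * bform M x y] is at most [c * (norm2 (x + y) ^+ 2 +
   norm2 (x - y) ^+ 2)], which is [4 * c] for unit vectors. *)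
have key x y : norm2 x = 1 -> norm2 y = 1 -> bform M x y <= c.
  move=> x1 y1; rewrite -(@ler_pM2l _ 4%:R)// bform_polar//.
  have := h (x + y); have := h (x - y); rewrite -[- y]scaleN1r !sqr_norm2.
  rewrite !(dotvDl, dotvDr, dotvZl, dotvZr) -!sqr_norm2 x1 y1 (dotvC y x).
  rewrite !ler_norml => /andP[h1 h2] /andP[h3 h4].
  by move: h1 h2 h3 h4; lra.
have [->|u0] := eqVneq u 0; first by rewrite norm20 mulr0 mul0r bform_dotl mul0mx /dotv mul0mx mxE.
have [->|v0] := eqVneq v 0; first by rewrite norm20 mulr0 bform_dotr mul0mx /dotv trmx0 mulmx0 mxE.
have pu := norm2_gt0 u0; have pv := norm2_gt0 v0.
have n1 (w : 'rV[R]_m) : 0 < norm2 w -> norm2 ((norm2 w)^-1 *: w) = 1.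
  by move=> pw; rewrite norm2Z gtr0_norm ?invr_gt0// mulVf// gt_eqF.
have := key _ _ (n1 _ pu) (n1 _ pv).
rewrite bformZl bformZr mulrA -invfM mulrC ler_pdivrMr; last exact: mulr_gt0.
by rewrite mulrA.
Qed.

(* Comparing norms on both sides of [D L = S D + F] is enough for the Sylvester
   equation, because [S] is bounded by [b] in norm and not only from above. *)
Lemma sylvester_opbound m k (D F : 'M[R]_(m, k)) (l : 'rV[R]_k) (S : 'M[R]_m)
    a b r : 0 <= b -> b < a -> (forall j, a <= l 0 j) -> opbound S b ->
  opbound F r -> D *m diag_mx l - S *m D = F -> opbound D (r / (a - b)).
Proof.
move=> b0 ba al hS hF eqD.
have a0 : 0 < a by exact: le_lt_trans ba.
have [c [hc cmin]] := opbound_min D.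
have eqD' : D = (S *m D + F) *m diag_mx (\row_j (l 0 j)^-1).
  rewrite -eqD addrC subrK -mulmxA mulmx_diag.
  rewrite -[LHS]mulmx1 -diag_const_mx; congr (_ *m diag_mx _).
  by apply/rowP => j; rewrite !mxE mulfV// gt_eqF// (lt_le_trans a0).
(* Minimality then gives [c <= (b * c + r) / a], which is solved for [c]. *)
have : opbound D ((b * c + r) * a^-1).
  rewrite eqD'; apply: opboundM; first by apply: opboundD => //; exact: opboundM.
  apply: opbound_diag => [|j]; first by rewrite invr_ge0 ltW.
  have l0 : 0 < l 0 j by exact: lt_le_trans (al j).
  by rewrite mxE gtr0_norm ?invr_gt0// lef_pV2.
move=> /cmin; rewrite ler_pdivlMr// => h.
apply: opbound_le hc; rewrite ler_pdivlMr ?subr_gt0//; move: h; lra.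
Qed.

End OperatorBounds.

(** * Spectra of symmetric matrices *)

Section Spectra.
Variable R : realType.

(* The supremum [mu] of the Rayleigh quotient is an eigenvalue: [mu - M] is
   positive semidefinite, and were it invertible it would be bounded below by a
   positive multiple of the identity. *)
Lemma rayleigh_max m (M : 'M[R]_m.+1) : M^T = M ->
  exists mu (x : 'rV[R]_m.+1), [/\ x != 0, x *m M = mu *: x &
    forall y, bform M y y <= mu * norm2 y ^+ 2].
Proof.
move=> sM; pose A := [set r | exists2 x : 'rV[R]_m.+1, norm2 x = 1 & r = bform M x x].
have A0 : A !=set0.
  by exists (bform M (delta_mx 0 0) (delta_mx 0 0)); exists (delta_mx 0 0); rewrite ?norm2_delta.
have [c hc] := opbound_ex M.
have ubA : ubound A c.
  move=> _ [x x1 ->]; have := opbound_bform x x hc.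
  by rewrite x1 !mulr1; apply: le_trans; exact: ler_norm.
have supA : has_sup A by split => //; exists c.
pose mu := sup A.
have hmu (y : 'rV[R]_m.+1) : bform M y y <= mu * norm2 y ^+ 2.
  have [->|y0] := eqVneq y 0.
    by rewrite norm20 expr0n/= mulr0 bform_dotl mul0mx /dotv mul0mx mxE.
  have py := norm2_gt0 y0.
  have : bform M ((norm2 y)^-1 *: y) ((norm2 y)^-1 *: y) <= mu.
    apply: sup_upper_bound => //; exists ((norm2 y)^-1 *: y) => //.
    by rewrite norm2Z gtr0_norm ?invr_gt0// mulVf// gt_eqF.
  by rewrite bformZl bformZr mulrA -invfM mulrC ler_pdivrMr ?mulr_gt0.
pose N := mu%:M - M.
have sN : N^T = N by rewrite /N linearB/= tr_scalar_mx sM.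
have bN (x : 'rV[R]_m.+1) : bform N x x = mu * norm2 x ^+ 2 - bform M x x.
  by rewrite bformD bformN bform_scalar sqr_norm2.
have pN x : 0 <= bform N x x by rewrite bN subr_ge0.
have [dN|dN] := boolP (\det N == 0).
  have /det0P[x x0 xN] := dN; exists mu, x; split=> //.
  by apply/eqP; rewrite eq_sym -subr_eq0 -mul_mx_scalar -mulmxBr xN.
have uN : N \in unitmx by rewrite unitmxE unitfE.
have [c1 [c10 h1]] := opbound_ex (invmx N).
have [c2 h2] := opbound_ex N.
(* Invertibility bounds [norm2 (x *m N)] below by [c1^-1], and Cauchy-Schwarz for the form [N]
   bounds its square by [c2 * bform N x x]. *)
have key (x : 'rV[R]_m.+1) : norm2 x = 1 -> 1 <= (c1 ^+ 2 * c2) * bform N x x.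
  move=> x1; have := h1 (x *m N); rewrite mulmxK// x1 => hx.
  have p : 0 < norm2 (x *m N).
    by rewrite lt_def norm2_ge0 andbT; apply/eqP => z; move: hx; rewrite z mulr0 leNgt ltr01.
  have := psd_CauchySchwarz x (x *m N) sN pN.
  rewrite [bform N x (x *m N)]bform_dotl -sqr_norm2 => hcs.
  have := opbound_bform (x *m N) (x *m N) h2.
  move=> /(le_trans (ler_norm _)) hq.
  have {}hq : norm2 (x *m N) ^+ 2 <= c2 * bform N x x.
    have p2 : 0 < norm2 (x *m N) ^+ 2 by rewrite exprn_gt0.
    rewrite -(ler_pM2r p2) -expr2 (le_trans hcs)// [c2 * _]mulrC -mulrA.
    by rewrite ler_wpM2l// expr2 mulrA.
  have : 1 ^+ 2 <= (c1 * norm2 (x *m N)) ^+ 2.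
    by rewrite ler_sqr ?nnegrE ?mulr_ge0 ?norm2_ge0.
  rewrite expr1n exprMn => h; apply: (le_trans h).
  by rewrite -mulrA ler_wpM2l ?sqr_ge0.
have K0 : 0 < c1 ^+ 2 * c2.
  have e1 := key _ (norm2_delta R 0); have := pN (delta_mx 0 0).
  have : 0 <= c1 ^+ 2 * c2 by rewrite mulr_ge0 ?sqr_ge0//; case: h2.
  rewrite le_eqVlt => /orP[/eqP z|//]; move: e1; rewrite -z mul0r.
  by rewrite leNgt ltr01.
have : mu <= mu - (c1 ^+ 2 * c2)^-1.
  apply: ge_sup => // _ [x x1 ->].
  have := key x x1; rewrite bN x1 expr1n mulr1 -ler_pdivrMl// mulr1.
  by lra.
by rewrite leNgt ltrBlDr ltrDl invr_gt0 K0.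
Qed.

(** Two sizes are allowed because the block matrix of [root_complement] has size
    [k + \rank (kermx V)], which equals [m] only provably. *)
Lemma char_poly_conj m n (A : 'M[R]_m) (B : 'M[R]_n) Q Q' :
  Q *m Q' = 1%:M -> Q' *m Q = 1%:M -> B *m Q = Q *m A ->
  char_poly A = char_poly B.
Proof.
move=> QQ' Q'Q; have mn : m = n.
  by apply/eqP; rewrite eqn_leq (mulmx1_min QQ') (mulmx1_min Q'Q).
subst n => eqB.
have -> : B = Q *m A *m Q' by rewrite -eqB -mulmxA QQ' mulmx1.
have eA : A = Q' *m (Q *m A *m Q') *m Q by rewrite !mulmxA Q'Q mul1mx -mulmxA Q'Q mulmx1.
set C := Q *m A *m Q' in eA *; rewrite eA.
have QQp : map_mx (@polyC R) Q *m map_mx (@polyC R) Q' = 1%:M.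
  by rewrite -map_mxM QQ' map_mx1.
rewrite /char_poly /char_poly_mx.
have -> : 'X%:M - map_mx (@polyC R) (Q' *m C *m Q) =
  map_mx (@polyC R) Q' *m ('X%:M - map_mx (@polyC R) C) *m map_mx (@polyC R) Q.
  rewrite mulmxBr mulmxBl -!map_mxM; congr (_ - _).
  by rewrite mul_mx_scalar -scalemxAl -map_mxM Q'Q map_mx1 scalemx1.
rewrite !det_mulmx mulrAC -det_mulmx.
by rewrite -map_mxM Q'Q map_mx1 det1 mul1r.
Qed.

(* The row basis [K] of the kernel of [V] completes [V^T] to an eigenbasis of
   blocks, without any orthonormal completion. *)
Lemma root_complement m k (M : 'M[R]_m) (V : 'M[R]_(m, k)) (d : 'rV[R]_k)
    (q : {poly R}) mu (x : 'rV[R]_m) : M^T = M -> V^T *m V = 1%:M ->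
  M *m V = V *m diag_mx d ->
  char_poly M = \prod_(j < k) ('X - (d 0 j)%:P) * q ->
  x != 0 -> x *m V = 0 -> x *m M = mu *: x -> root q mu.
Proof.
move=> sM VV MV cM x0 xV xM.
have VM : V^T *m M = diag_mx d *m V^T.
  by rewrite -{1}sM -trmx_mul MV trmx_mul tr_diag_mx.
pose K := row_base (kermx V).
have KV : K *m V = 0 by apply/sub_kermxP; rewrite eq_row_base.
pose Pp := 1%:M - V *m V^T.
pose L := Pp *m pinvmx K.
have KP : K *m Pp = K by rewrite /Pp mulmxBr mulmx1 mulmxA KV mul0mx subr0.
have PV : Pp *m V = 0 by rewrite /Pp mulmxBl mul1mx -mulmxA VV mulmx1 subrr.
have VP : V^T *m Pp = 0 by rewrite /Pp mulmxBr mulmx1 mulmxA VV mul1mx subrr.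
have KL : K *m L = 1%:M by rewrite /L mulmxA KP mulmxVp// row_base_free.
have subK (p : nat) (Z : 'M[R]_(p, m)) : Z *m V = 0 -> Z *m pinvmx K *m K = Z.
  by move=> ZV; apply: mulmxKpV; rewrite eq_row_base; apply/sub_kermxP.
have LK : L *m K = Pp by exact: subK.
have VL : V^T *m L = 0 by rewrite /L mulmxA VP mul0mx.
have KMK : K *m M *m L *m K = K *m M.
  rewrite -mulmxA LK /Pp mulmxBr mulmx1 -[K *m M *m _]mulmxA (mulmxA M V) MV.
  by rewrite !mulmxA KV !mul0mx subr0.
pose Q := col_mx V^T K; pose Q' := row_mx V L.
have QQ' : Q *m Q' = 1%:M.
  by rewrite mul_col_row VV VL KV KL scalar_mx_block.
have Q'Q : Q' *m Q = 1%:M by rewrite mul_row_col LK addrC subrK.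
pose B := block_mx (diag_mx d) 0 0 (K *m M *m L).
have BQ : B *m Q = Q *m M.
  by rewrite mul_block_col !mul0mx addr0 add0r KMK mul_col_mx VM.
have := char_poly_conj QQ' Q'Q BQ.
rewrite cM /char_poly /B char_block_diag_mx det_ublock.
have -> : \det (char_poly_mx (diag_mx d)) = \prod_(j < k) ('X - (d 0 j)%:P).
  rewrite -/(char_poly _) char_poly_trig ?diag_mx_is_trig//.
  by apply: eq_bigr => j _; rewrite mxE eqxx mulr1n.
move=> /mulfI -> //; last first.
  by rewrite monic_neq0// monic_prod// => j _; rewrite monicXsubC.
rewrite -/(char_poly _) -eigenvalue_root_char; apply/eigenvalueP.
exists (x *m pinvmx K); last first.
  apply: contra x0 => /eqP z; by rewrite -(subK _ _ xV) z mul0mx.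
have -> : x *m pinvmx K *m (K *m M *m L) = x *m M *m L.
  by rewrite (mulmxA _ (K *m M)) (mulmxA _ K) (subK _ _ xV).
have xP : x *m Pp = x by rewrite /Pp mulmxBr mulmx1 mulmxA xV mul0mx subr0.
by rewrite xM -!scalemxAl /L mulmxA xP.
Qed.

Lemma size_ordered_eigenvalues m (M : 'M[R]_m) l :
  ordered_eigenvalues M l -> size l = m.
Proof.
by move=> [_ /(congr1 (fun q : {poly R} => size q))]; rewrite size_char_poly size_prod_XsubC => -[].
Qed.

Lemma eigval_anti m (M : 'M[R]_m) l i j : ordered_eigenvalues M l ->
  (i <= j < m)%N -> eigval l j.+1 <= eigval l i.+1.
Proof.
move=> hl /andP[ij jm]; have sl := size_ordered_eigenvalues hl.
case: hl => so _; rewrite /eigval/=.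
have tr : transitive (fun x y : R => y <= x) by move=> y x z /= h1 h2; exact: le_trans h1.
by apply: (sorted_leq_nth tr) => //; rewrite ?inE ?sl//; exact: leq_ltn_trans jm.
Qed.

Lemma ortho_cols_leq m k (V : 'M[R]_(m, k)) : V^T *m V = 1%:M -> (k <= m)%N.
Proof. exact: mulmx1_min. Qed.

(** Deflation: [M'] lowers the [k] leading eigenvalues to [c] and agrees with [M] on the complement
    of [V]. A Rayleigh maximum [mu > c] of [M'] would have its eigenvector orthogonal to [V], so by
    [root_complement] it would be one of the remaining eigenvalues of [M], all at most [c]. *)
Lemma bform_complement m k (M : 'M[R]_m) l (V : 'M[R]_(m, k)) x :
  M^T = M -> ordered_eigenvalues M l -> leading_eigenvectors M l V ->
  x *m V = 0 -> bform M x x <= eigval l k.+1 * norm2 x ^+ 2.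
Proof.
move=> sM hl [VV MV] xV; have km := ortho_cols_leq VV.
have sl := size_ordered_eigenvalues hl.
(* When [k = m], [eigval l k.+1] is the default value 0, but then only [x = 0] is orthogonal to
   [V]. *)
move: km; rewrite leq_eqVlt => /orP[/eqP km|km].
  have -> : x = 0.
    have VV' : V *m V^T = 1%:M by case: _ / km V VV {MV xV} => V; exact: mulmx1C.
    by rewrite -[x]mulmx1 -VV' mulmxA xV mul0mx.
  by rewrite norm20 expr0n/= mulr0 bform_dotl mul0mx /dotv mul0mx mxE.
case: m M l V x sM hl VV MV xV sl km => // m M l V x sM hl VV MV xV sl km.
set d := \row_(j < k) eigval l j.+1 in MV.
set c := eigval l k.+1.
have VM : V^T *m M = diag_mx d *m V^T.
  by rewrite -{1}sM -trmx_mul MV trmx_mul tr_diag_mx.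
pose M' := M + V *m diag_mx (const_mx c - d) *m V^T.
have sM' : M'^T = M'.
  by rewrite /M' linearD/= sM !trmx_mul trmxK tr_diag_mx mulmxA.
have M'V : M' *m V = c *: V.
  rewrite /M' mulmxDl MV -[_ *m V^T *m V]mulmxA VV mulmx1 -mulmxDr -linearD/=.
  by rewrite addrC subrK diag_const_mx mul_mx_scalar.
have M'x z : z *m V = 0 -> z *m M' = z *m M.
  by move=> zV; rewrite /M' mulmxDr !mulmxA zV !mul0mx addr0.
have [mu [y [y0 yM' hmu]]] := rayleigh_max sM'.
have := hmu x; rewrite bform_dotl M'x// -bform_dotl.
have [muc|cmu] := leP mu c.
  by move=> h; rewrite (le_trans h)// ler_wpM2r ?sqr_ge0.
have yV : y *m V = 0.
  have : y *m M' *m V = y *m (M' *m V) by rewrite mulmxA.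
  rewrite yM' M'V -scalemxAl -scalemxAr => /eqP; rewrite -subr_eq0 -scalerBl.
  by rewrite scaler_eq0 subr_eq0 gt_eqF//= => /eqP.
have yM : y *m M = mu *: y by rewrite -M'x.
have cM : char_poly M = \prod_(j < k) ('X - (d 0 j)%:P) * \prod_(z <- drop k l) ('X - z%:P).
  case: hl => _ ->; rewrite -{1}(cat_take_drop k l) big_cat/=; congr (_ * _).
  rewrite (big_nth 0) size_take sl km big_mkord; apply: eq_bigr => j _.
  by rewrite mxE nth_take.
have := root_complement sM VV MV cM y0 yV yM.
rewrite root_prod_XsubC => /(nthP 0)[i]; rewrite size_drop sl nth_drop => im emu.
suff : mu <= c by rewrite leNgt cmu.
rewrite -emu -[nth _ _ _]/(eigval l (k + i).+1); apply: (eigval_anti hl).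
by rewrite leq_addr/=; move: im; rewrite ltn_subRL.
Qed.

(** By monotonicity only the last of the [k] eigenvalues matters. A dimension count finds a nonzero
    vector in the span of [U] orthogonal to all leading eigenvectors but the last; there the form is
    at least [a] by hypothesis and at most that eigenvalue by [bform_complement]. *)
Lemma weyl_lower m k (M : 'M[R]_m) l (V U : 'M[R]_(m, k)) a :
  M^T = M -> ordered_eigenvalues M l -> leading_eigenvectors M l V ->
  U^T *m U = 1%:M ->
  (forall y, a * norm2 y ^+ 2 <= bform M (y *m U^T) (y *m U^T)) ->
  forall j : 'I_k, a <= eigval l j.+1.
Proof.
case: k V U => [|k] V U sM hl [VV MV] UU hU; first by case.
suff : a <= eigval l k.+1.
  move=> h j; apply: (le_trans h); apply: (eigval_anti hl).
  by rewrite -ltnS ltn_ord (ortho_cols_leq VV).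
pose f (j : 'I_k) : 'I_k.+1 := widen_ord (leqnSn k) j.
pose V' := colsub f V.
have VV' : V'^T *m V' = 1%:M.
  apply/matrixP => i j; have := congr1 (fun Z : 'M[R]_k.+1 => Z (f i) (f j)) VV.
  rewrite !mxE => <-; by apply: eq_bigr => z _; rewrite !mxE.
have lV' : leading_eigenvectors M l V'.
  split=> //; apply/matrixP => i j.
  have := congr1 (fun Z : 'M[R]_(m, k.+1) => Z i (f j)) MV.
  rewrite /V' !mul_mx_diag !mxE => e.
  by rewrite -[RHS]e; apply: eq_bigr => z _; rewrite !mxE.
have : (\rank (kermx (U^T *m V')) != 0)%N.
  rewrite mxrank_ker -lt0n subn_gt0; exact: leq_ltn_trans (rank_leq_col _) _.
rewrite mxrank_eq0 => /rowV0Pn[y /sub_kermxP yK y0].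
have := bform_complement (x := y *m U^T) sM hl lV'; rewrite -mulmxA => /(_ yK).
rewrite isometry_norm2 ?trmxK// => /(le_trans (hU y)).
by rewrite ler_pM2r// exprn_gt0// norm2_gt0.
Qed.

(** The reflection along [x - e] exchanges the unit vectors [e] and [x]; it degenerates when they
    coincide, where the identity serves. *)
Lemma householder m (x : 'rV[R]_m.+1) : norm2 x = 1 ->
  exists H : 'M[R]_m.+1, [/\ H^T = H, H *m H = 1%:M & delta_mx 0 0 *m H = x].
Proof.
move=> x1; have [->|w0] := eqVneq x (delta_mx 0 0).
  by exists 1%:M; rewrite trmx1 !mulmx1.
set e : 'rV[R]_m.+1 := delta_mx 0 0 in w0 *; pose w := x - e.
have {}w0 : dotv w w != 0.
  rewrite -sqr_norm2 expf_eq0/=; apply: contra w0 => /eqP /norm2_eq0 /eqP.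
  by rewrite subr_eq0.
pose t := 2 / dotv w w.
exists (1%:M - t *: (w^T *m w)).
have ww : w *m w^T = (dotv w w)%:M by rewrite [LHS]mx11_scalar.
split.
- by rewrite linearB/= linearZ/= trmx1 trmx_mul trmxK.
- have WW : w^T *m w *m (w^T *m w) = dotv w w *: (w^T *m w).
    by rewrite mulmxA -(mulmxA _ w) ww mul_mx_scalar -scalemxAl.
  rewrite mulmxBr mulmx1 mulmxBl mul1mx -scalemxAl -scalemxAr WW !scalerA.
  have -> : t * t * dotv w w = t + t by rewrite /t; field.
  by rewrite scalerDl opprB addrK subrK.
- rewrite mulmxBr mulmx1 -scalemxAr mulmxA.
  have -> : e *m w^T = (dotv e w)%:M by rewrite [LHS]mx11_scalar.
  rewrite mul_scalar_mx scalerA.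
  have ee : dotv e e = 1 by rewrite -sqr_norm2 norm2_delta expr1n.
  have xx : dotv x x = 1 by rewrite -sqr_norm2 x1 expr1n.
  have -> : t * dotv e w = -1.
    move: w0; rewrite /t /w -scaleN1r !(dotvDl, dotvDr, dotvZl, dotvZr) ee xx.
    by rewrite (dotvC x e) => w0; field; move: w0; congr (_ != _); ring.
  by rewrite scaleN1r opprK addrC /w subrK.
Qed.

(** Induction on the size: conjugating by a reflection that carries the first basis vector to an
    eigenvector splits off a block of size 1. *)
Lemma spectral_symmetric m (M : 'M[R]_m) : M^T = M ->
  exists (Q : 'M[R]_m) (d : 'rV[R]_m), Q^T *m Q = 1%:M /\ M = Q *m diag_mx d *m Q^T.
Proof.
elim: m M => [|m IH] M sM; first by exists 0, 0; split; apply/matrixP => -[].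
have [mu [x0 [x00 x0M _]]] := rayleigh_max sM.
pose x := (norm2 x0)^-1 *: x0.
have px := norm2_gt0 x00.
have x1 : norm2 x = 1 by rewrite norm2Z gtr0_norm ?invr_gt0// mulVf// gt_eqF.
have xM : x *m M = mu *: x by rewrite -scalemxAl x0M !scalerA mulrC.
have [H [sH HH eH]] := householder x1.
have [N defN] : exists N : 'M[R]_(1 + m), N = H *m M *m H by eexists.
have sN : N^T = N by rewrite defN; rewrite [LHS]trmx_mul trmx_mul sM sH -mulmxA.
have eN j : N 0 j = mu *+ (j == 0).
  have : delta_mx 0 0 *m (H *m M *m H) = mu *: delta_mx 0 0 :> 'rV_m.+1.
    by rewrite !mulmxA eH xM -scalemxAl -eH -mulmxA HH mulmx1.
  move=> /(congr1 (fun Z : 'rV[R]_m.+1 => Z 0 j)).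
  by rewrite -rowE -defN !mxE eqxx/= mulr_natr.
have l0 : lshift m (0 : 'I_1) = 0 :> 'I_m.+1 by exact: val_inj.
have uN : ursubmx N = 0.
  by apply/matrixP => i j; rewrite !mxE (ord1 i) l0 eN mulr0n.
have uN0 : ulsubmx N = mu%:M.
  by apply/matrixP => i j; rewrite !mxE !ord1 l0 eN.
have dN : dlsubmx N = 0 by rewrite -[N]sN -trmx_ursub uN trmx0.
have sN' : (drsubmx N)^T = drsubmx N by rewrite trmx_drsub sN.
have [Q' [d' [QQ' eN']]] := IH _ sN'.
pose Qb : 'M[R]_(1 + m) := block_mx 1%:M 0 0 Q'.
have QQb : Qb^T *m Qb = 1%:M.
  rewrite /Qb tr_block_mx !trmx0 trmx1 mulmx_block !mulmx0 !mul0mx !mulmx1.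
  by rewrite !addr0 !add0r QQ' -scalar_mx_block.
have eNb : N = Qb *m diag_mx (row_mx (mu%:M : 'rV_1) d') *m Qb^T.
  rewrite -[LHS]submxK uN uN0 dN eN' diag_mx_row /Qb tr_block_mx !trmx0 trmx1.
  rewrite !mulmx_block !mulmx0 !mul0mx !mul1mx !mulmx1 !addr0 !add0r.
  congr (block_mx _ _ _ _); last by rewrite mul0mx.
  by apply/matrixP => i j; rewrite !mxE !ord1 eqxx.
exists (H *m Qb), (row_mx (mu%:M : 'rV_1) d'); split.
  by rewrite trmx_mul sH mulmxA -(mulmxA _ H H) HH mulmx1.
have HMH : H *m (H *m M *m H) *m H = M.
  by rewrite !mulmxA HH mul1mx -mulmxA HH mulmx1.
by rewrite -[LHS]HMH -defN eNb trmx_mul sH !mulmxA.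
Qed.

(** The witness is the polar factor [A (A^T A)^(-1/2)], defined because [g < 1] makes [A^T A]
    positive definite. Then [A - W = W ((A^T A)^(1/2) - 1)], and [|sqrt d - 1| <= |d - 1|] on the
    spectrum. *)
Lemma polar_near m (A : 'M[R]_m) g : g < 1 -> opbound (1%:M - A^T *m A) g ->
  exists W : 'M[R]_m, orthogonal_mx W /\ opbound (A - W) g.
Proof.
move=> g1 hg; have g0 : 0 <= g by case: hg.
have [|Q [d [QQ eA]]] := @spectral_symmetric m (A^T *m A).
  by rewrite trmx_mul trmxK.
have QQ' : Q *m Q^T = 1%:M by exact: mulmx1C.
have hd j : `|1 - d 0 j| <= g.
  have e1 : bform (1%:M - A^T *m A) (delta_mx 0 j *m Q^T) (delta_mx 0 j *m Q^T) = 1 - d 0 j.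
    rewrite -bform_mul trmxK eA mulmxBr mulmx1 mulmxBl QQ !mulmxA QQ mul1mx.
    rewrite -mulmxA QQ mulmx1 bformD bformN bform1 -sqr_norm2 norm2_delta expr1n.
    congr (_ - _); rewrite /bform -rowE trmx_delta -colE !mxE eqxx mulr1n.
    by [].
  have := opbound_bform (delta_mx 0 j *m Q^T) (delta_mx 0 j *m Q^T) hg.
  by rewrite e1 !isometry_norm2 ?trmxK// norm2_delta !mulr1.
have d0 j : 0 < d 0 j by have := hd j; rewrite ler_norml => /andP[]; lra.
pose r := \row_j Num.sqrt (d 0 j); pose ri := \row_j (r 0 j)^-1.
have r0 j : 0 < r 0 j by rewrite mxE sqrtr_gt0.
have rri : diag_mx r *m diag_mx ri = 1%:M.
  rewrite mulmx_diag -diag_const_mx; congr diag_mx.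
  by apply/rowP => j; rewrite mxE [ri 0 j]mxE mulfV ?gt_eqF// mxE.
have rir : diag_mx ri *m diag_mx r = 1%:M by exact: mulmx1C.
have rr : diag_mx d = diag_mx r *m diag_mx r.
  rewrite mulmx_diag; congr diag_mx; apply/rowP => j.
  by rewrite !mxE -expr2 sqr_sqrtr// ltW.
pose W := A *m Q *m diag_mx ri *m Q^T.
have WW : W^T *m W = 1%:M.
  rewrite /W !trmx_mul trmxK tr_diag_mx -!mulmxA (mulmxA A^T) eA.
  rewrite -!mulmxA (mulmxA Q^T) QQ mul1mx rr -!mulmxA (mulmxA Q^T) QQ mul1mx.
  rewrite (mulmxA (diag_mx r) _ Q^T) rri mul1mx (mulmxA (diag_mx ri)) rir mul1mx.
  by rewrite QQ'.
exists W; split; first by split=> //; exact: mulmx1C.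
have -> : A - W = W *m (Q *m diag_mx (r - const_mx 1) *m Q^T).
  rewrite linearB/= diag_const_mx mulmxBr mulmxBl mulmx1 QQ' mulmxBr mulmx1.
  congr (_ - _); rewrite /W -!mulmxA (mulmxA Q^T) QQ mul1mx (mulmxA _ (diag_mx r)).
  by rewrite rir mul1mx QQ' mulmx1.
rewrite -[g]mul1r; apply: opboundM; first exact: opbound_ortho.
rewrite -[g]mulr1 -[g]mul1r; apply: opboundM; first apply: opboundM.
- exact: opbound_ortho.
- apply: opbound_diag => // j; rewrite !mxE.
  apply: le_trans (hd j).
  have s0 := sqrtr_ge0 (d 0 j).
  have -> : 1 - d 0 j = - ((Num.sqrt (d 0 j) - 1) * (Num.sqrt (d 0 j) + 1)).
    by rewrite -{1}(sqr_sqrtr (ltW (d0 j))); ring.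
  by rewrite normrN normrM ler_peMr// ger0_norm ?lerDr// addr_ge0.
- by apply: opbound_tr; exact: opbound_ortho.
Qed.

End Spectra.

(** * Perturbation of eigenvectors *)

Section Perturbation.
Variables (R : realType) (m k : nat).
Variables (S : 'M[R]_m) (U : 'M[R]_(m, k)) (l : 'rV[R]_k) (lk b : R).
Hypotheses (symS : S^T = S) (orthU : U^T *m U = 1%:M).
Hypotheses (eigU : S *m U = U *m diag_mx l) (lk_le : forall j, lk <= l 0 j).
Hypotheses (lk_gt0 : 0 < lk) (b_ge0 : 0 <= b) (b_le : b <= lk / 2).
Hypothesis compl_ge0 : forall x, x *m U = 0 -> 0 <= bform S x x.
Hypothesis compl_le : forall x, x *m U = 0 -> bform S x x <= b * norm2 x ^+ 2.

Definition projc : 'M[R]_m := 1%:M - U *m U^T.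
Definition compress : 'M[R]_m := projc *m S *m projc.

(* [resolvent (l 0 j) *m E *m col j U] is the first-order correction to the j-th
   eigenvector. *)
Definition resolvent (z : R) : 'M[R]_m := invmx (z%:M - compress) *m projc.

Lemma projc_sym : projc^T = projc.
Proof. by rewrite /projc linearB/= trmx1 trmx_mul trmxK. Qed.

Lemma mul_projc_U : projc *m U = 0.
Proof. by rewrite /projc mulmxBl mul1mx -mulmxA orthU mulmx1 subrr. Qed.

Lemma projc_idem : projc *m projc = projc.
Proof. by rewrite {2}/projc mulmxBr mulmx1 mulmxA mul_projc_U mul0mx subr0. Qed.

Lemma opbound_projc : opbound projc 1.
Proof.
split=> // u; rewrite mul1r; have := norm2_ge0 (u *m projc).
rewrite le_eqVlt => /orP[/eqP <-|p]; first exact: norm2_ge0.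
rewrite -(ler_pM2l p) -expr2 sqr_norm2.
have -> : dotv (u *m projc) (u *m projc) = dotv (u *m projc) u.
  by rewrite -[LHS]bform_dotl bform_dotr projc_sym -mulmxA projc_idem dotvC.
exact: le_trans (ler_norm _) (CauchySchwarz _ _).
Qed.

Lemma compress_sym : compress^T = compress.
Proof. by rewrite /compress !trmx_mul symS projc_sym mulmxA. Qed.

Lemma bform_compress x : bform compress x x = bform S (x *m projc) (x *m projc).
Proof. by rewrite -bform_mul projc_sym. Qed.

Lemma opbound_compress : opbound compress b.
Proof.
apply: opbound_sym => // [|x]; first exact: compress_sym.
have xPU : x *m projc *m U = 0 by rewrite -mulmxA mul_projc_U mulmx0.
rewrite bform_compress ger0_norm ?compl_ge0// (le_trans (compl_le xPU))//.
rewrite ler_wpM2l// ler_sqr ?nnegrE ?norm2_ge0//.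
by have [_ /(_ x)] := opbound_projc; rewrite mul1r.
Qed.

Lemma shifted_lower z u : lk <= z ->
  (lk - b) * norm2 u <= norm2 (u *m (z%:M - compress)).
Proof.
move=> lkz; have [_ /(_ u) h] := opbound_compress.
have : norm2 (z *: u) <= norm2 (u *m (z%:M - compress)) + norm2 (u *m compress).
  by apply: le_trans (ler_norm2D _ _); rewrite mulmxBr mul_mx_scalar subrK.
rewrite norm2Z gtr0_norm; last exact: lt_le_trans lkz.
have := norm2_ge0 u; move: h; nra.
Qed.

Lemma gap_gt0 : 0 < lk - b.
Proof. by move: lk_gt0 b_le; lra. Qed.

Lemma shifted_unit z : lk <= z -> z%:M - compress \in unitmx.
Proof.
move=> lkz; rewrite unitmxE unitfE; apply/negP => /det0P[v v0 vz].
have := shifted_lower v lkz; rewrite vz norm20 leNgt.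
by rewrite mulr_gt0 ?gap_gt0 ?norm2_gt0.
Qed.

Lemma opbound_resolvent z : lk <= z -> opbound (resolvent z) (2 / lk).
Proof.
move=> lkz; rewrite -[2 / lk]mulr1; apply: opboundM opbound_projc.
split=> [|u]; first by rewrite divr_ge0// ltW.
have := shifted_lower (u *m invmx (z%:M - compress)) lkz.
rewrite mulmxKV ?shifted_unit// => h.
rewrite mulrAC ler_pdivlMr//.
have := norm2_ge0 (u *m invmx (z%:M - compress)); move: b_le h; nra.
Qed.

Variables (E : 'M[R]_m) (V : 'M[R]_(m, k)) (lh : 'rV[R]_k) (e tau : R).
Hypotheses (orthV : V^T *m V = 1%:M).
Hypotheses (eigV : (S + E) *m V = V *m diag_mx lh).
Hypotheses (lh_ge : forall j, lk - e <= lh 0 j).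
Hypotheses (boundE : opbound E e) (e_le : e <= lk / 5).
Hypothesis tau_ge0 : 0 <= tau.
Hypothesis entry_le : forall i j, `|(resolvent (l 0 j) *m E *m U) i j| <= tau.

(* Split [V = U A + B] along [U]. The part [B] solves a Sylvester equation whose
   first-order solution is [X A], where [X] has the resolvent entries bounded
   by [tau]; the remainder [D] is quadratic in [e / lk], and [A] is within
   [|B|^2] of its orthogonal polar factor. *)
Lemma eigenvector_perturbation : exists W : 'M[R]_k, orthogonal_mx W /\
  forall i, norm2 (row i (V - U *m W)) <=
    Num.sqrt k%:R * tau + 40 * (e / lk) ^+ 2.
Proof.
have e0 : 0 <= e by case: boundE.
pose A := U^T *m V; pose B := projc *m V.
have VE : V = U *m A + B.
  by rewrite /A /B mulmxA -mulmxDl addrC subrK mul1mx.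
have hU := opbound_ortho orthU; have hV := opbound_ortho orthV.
have hA : opbound A 1 by rewrite -[1]mulr1; apply: opboundM => //; exact: opbound_tr.
have hP := opbound_projc; have hSp := opbound_compress.
have PB : projc *m B = B by rewrite /B mulmxA projc_idem.
have PSU : projc *m S *m U = 0 by rewrite -mulmxA eigU mulmxA mul_projc_U mul0mx.
have US : U^T *m S = diag_mx l *m U^T.
  by rewrite -{1}symS -trmx_mul eigU trmx_mul tr_diag_mx.
have PSV : projc *m S *m V = compress *m B.
  rewrite {1}VE mulmxDr [X in X + _]mulmxA PSU mul0mx add0r /compress.
  by rewrite -[in RHS]mulmxA PB.
have eqB : B *m diag_mx lh - compress *m B = projc *m E *m V.
  have -> : B *m diag_mx lh = projc *m S *m V + projc *m E *m V.
    by rewrite -[LHS]mulmxA -eigV (mulmxDl S E) mulmxDr !mulmxA.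
  by rewrite PSV addrAC subrr add0r.
(* Room is available: [1 - 1/5 - 1/2 = 3/10]. *)
have gap : lk / 4 <= lk - e - b by move: b_le e_le lk_gt0; lra.
have gap0 : 0 < lk / 4 by rewrite divr_gt0.
have hB : opbound B (4 * (e / lk)).
  have -> : 4 * (e / lk) = e / (lk / 4) by field; rewrite gt_eqF.
  apply: opbound_le (sylvester_opbound (r := e) b_ge0 _ lh_ge hSp _ eqB).
  - by rewrite ler_wpM2l// lef_pV2 ?posrE//; move: gap gap0 b_le lk_gt0; lra.
  - by move: gap gap0; lra.
  - by rewrite -[e]mulr1 -[e]mul1r; apply: opboundM => //; exact: opboundM.
(* The equation for [B] with the true eigenvalues and eigenvectors in place of the sample ones;
   inverting [l 0 j - compress] column by column solves it exactly. *)
pose X := \matrix_(i, j) (resolvent (l 0 j) *m E *m U) i j.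
have eqX : X *m diag_mx l - compress *m X = projc *m E *m U.
  apply/matrixP => i j.
  have -> : (projc *m E *m U) i j =
      (((l 0 j)%:M - compress) *m (resolvent (l 0 j) *m E *m U)) i j.
    by rewrite /resolvent !mulmxA mulmxV ?shifted_unit// mul1mx.
  rewrite mulmxBl mul_scalar_mx mul_mx_diag !mxE mulrC; congr (_ - _).
  by apply: eq_bigr => h _; rewrite [X h j]mxE.
have hX : opbound X (2 * (e / lk)).
  have -> : 2 * (e / lk) = e / (lk / 2) by field; rewrite gt_eqF.
  apply: opbound_le (sylvester_opbound (r := e) b_ge0 _ lk_le hSp _ eqX).
  - by rewrite ler_wpM2l// lef_pV2 ?posrE//; move: b_le lk_gt0; lra.
  - by move: b_le lk_gt0; lra.
  - by rewrite -[e]mulr1 -[e]mul1r; apply: opboundM => //; exact: opboundM.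
pose D := B - X *m A.
have AL : A *m diag_mx lh = diag_mx l *m A + U^T *m E *m V.
  by rewrite /A -mulmxA -eigV !mulmxDl !mulmxDr !mulmxA US.
have eqD : D *m diag_mx lh - compress *m D =
    projc *m E *m B - X *m (U^T *m E *m V).
  have -> : D *m diag_mx lh - compress *m D = (B *m diag_mx lh - compress *m B)
      - ((X *m diag_mx l - compress *m X) *m A + X *m (U^T *m E *m V)).
    rewrite /D !mulmxBl !mulmxBr -[X *m A *m _]mulmxA AL mulmxDr !mulmxA.
    by rewrite !opprD !opprK !addrA [LHS](ACl (1*4*2*5*3)).
  rewrite eqB eqX {1}VE mulmxDr !mulmxA opprD addrA; congr (_ - _).
  by rewrite addrC addKr.
(* Both source terms of [eqD] carry [E] together with a factor of order [e / lk], namely [B] or [X];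
   [24 = (4 + 2) * 4]. *)
have hD : opbound D (24 * (e / lk) ^+ 2).
  have -> : 24 * (e / lk) ^+ 2 = (e * (4 * (e / lk)) + (2 * (e / lk)) * e) / (lk / 4).
    by field; rewrite gt_eqF.
  apply: opbound_le (sylvester_opbound (r := e * (4 * (e / lk)) + 2 * (e / lk) * e)
    b_ge0 _ lh_ge hSp _ eqD).
  - rewrite ler_wpM2l ?lef_pV2 ?posrE//; last by move: gap gap0; lra.
    by rewrite addr_ge0// !mulr_ge0// invr_ge0 ltW.
  - by move: gap gap0; lra.
  - apply: opboundB; apply: opboundM => //.
      by rewrite -[e]mul1r; exact: opboundM.
    rewrite -[e]mulr1 -[e]mul1r; apply: opboundM => //.
    by apply: opboundM => //; exact: opbound_tr.
have elk : 0 <= e / lk <= 1 / 5.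
  apply/andP; split; first by rewrite divr_ge0// ltW.
  by rewrite ler_pdivrMr//; move: e_le; lra.
have hAA : opbound (1%:M - A^T *m A) (16 * (e / lk) ^+ 2).
  have -> : 1%:M - A^T *m A = B^T *m B.
    rewrite /A /B !trmx_mul trmxK projc_sym !mulmxA -(mulmxA V^T projc projc) projc_idem.
    by rewrite /projc mulmxBr mulmx1 mulmxBl orthV !mulmxA.
  have -> : 16 * (e / lk) ^+ 2 = (4 * (e / lk)) * (4 * (e / lk)) by ring.
  by apply: opboundM => //; exact: opbound_tr.
(* The requirement [g < 1] holds since [16 * (1/5)^2 = 16/25]. Adding this 16 to the 24 for [D]
   gives the final 40. *)
have [|W [oW hW]] := polar_near _ hAA.
  by move: elk; set z := e / lk => /andP[z0 z1]; nra.
exists W; split=> // i.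
have -> : V - U *m W = U *m (A - W) + X *m A + D.
  rewrite {1}VE mulmxBr /D !addrA [RHS](ACl (1*4*2*(3*5)))/=.
  by rewrite subrr addr0.
have rowD (F G : 'M[R]_(m, k)) : row i (F + G) = row i F + row i G.
  exact: raddfD.
rewrite (rowD _ D) (rowD _ (X *m A)).
apply: (le_trans (ler_norm2D _ _)); have h1 := opbound_row i hD.
have h4 := ler_norm2D (row i (U *m (A - W))) (row i (X *m A)).
have h2 : norm2 (row i (U *m (A - W))) <= 16 * (e / lk) ^+ 2.
  by apply: opbound_row; rewrite -[_ * _ ^+ 2]mul1r; exact: opboundM.
have h3 : norm2 (row i (X *m A)) <= Num.sqrt k%:R * tau.
  rewrite row_mul; have [_ /(_ (row i X))] := hA; rewrite mul1r => /le_trans; apply.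
  rewrite -[tau]ger0_norm// -sqrtr_sqr -sqrtrM ?ler0n// ler_sqrt; last first.
    by rewrite mulr_ge0 ?sqr_ge0 ?ler0n.
  rewrite mulr_natl -[in leRHS](card_ord k) -sumr_const; apply: ler_sum => j _.
  rewrite mxE [X i j]mxE -[leLHS]real_normK ?num_real// ler_sqr ?nnegrE//.
move: h1 h2 h3 h4; lra.
Qed.
End Perturbation.

(** * An integer grid as a net of the unit sphere *)

Section GridNet.
Variable R : realType.

(** The integer points of the cube of half-side [4 * m]. They are left unscaled because a bound on a
    quadratic form relative to [norm2 ^+ 2] is invariant under scaling. *)
Definition grid_row m (f : {ffun 'I_m -> 'I_(8 * m).+1}) : 'rV[R]_m :=
  \row_j ((f j)%:R - (4 * m)%:R).

(** Rounding each coordinate down on the mesh [1 / (4 m)] costs at most [sqrt m / (4 m) <= 1/4] in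
    Euclidean norm. *)
Lemma grid_approx m (x : 'rV[R]_m) : norm2 x = 1 ->
  exists f, norm2 (x - (4 * m)%:R^-1 *: grid_row f) <= 1 / 4.
Proof.
move=> x1.
have m0 : (0 < m)%N.
  case: m x x1 => // x; rewrite /norm2 big_ord0 sqrtr0 => /eqP.
  by rewrite eq_sym oner_eq0.
have m0' : 0 < (4 * m)%:R :> R by rewrite ltr0n muln_gt0.
have xj j : -1 <= x 0 j <= 1.
  rewrite -ler_norml -ler_sqr ?nnegrE// real_normK ?num_real// expr1n.
  have <- : norm2 x ^+ 2 = 1 by rewrite x1 expr1n.
  rewrite sqr_norm2 dotvE (bigD1 j)//= expr2 lerDl sumr_ge0// => i _.
  by rewrite -expr2 sqr_ge0.
pose t j := Num.truncn ((4 * m)%:R * (x 0 j + 1) : R).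
have arg0 j : 0 <= (4 * m)%:R * (x 0 j + 1) :> R.
  by rewrite mulr_ge0 ?ler0n//; have := xj j; lra.
have tle j : (t j < (8 * m).+1)%N.
  rewrite ltnS -(ler_nat R); have /andP[h _] := Num.Theory.truncn_itv (arg0 j).
  apply: (le_trans h); have -> : (8 * m)%:R = (4 * m)%:R * 2 :> R.
    by rewrite -natrM; congr _%:R; lia.
  by rewrite ler_pM2l//; have := xj j; lra.
exists [ffun j => Ordinal (tle j)].
rewrite -ler_sqr ?nnegrE ?norm2_ge0// sqr_norm2 dotvE.
have h j : (x - (4 * m)%:R^-1 *: grid_row [ffun j => Ordinal (tle j)]) 0 j *
    (x - (4 * m)%:R^-1 *: grid_row [ffun j => Ordinal (tle j)]) 0 j <=
    ((4 * m)%:R^-1) ^+ 2.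
  rewrite !mxE ffunE/= -expr2.
  have /andP[h1 h2] := Num.Theory.truncn_itv (arg0 j); rewrite -/(t j) in h1 h2.
  have -> : x 0 j - (4 * m)%:R^-1 * ((t j)%:R - (4 * m)%:R) =
    (4 * m)%:R^-1 * ((4 * m)%:R * (x 0 j + 1) - (t j)%:R).
    by field; rewrite pnatr_eq0 -lt0n.
  rewrite exprMn ler_piMr ?sqr_ge0//.
  by rewrite expr_le1// ?subr_ge0// lerBlDl natr1 ltW.
apply: (le_trans (ler_sum _ (fun j _ => h j))).
rewrite sumr_const card_ord -[leLHS]mulr_natl.
have mR : 1 <= m%:R :> R by rewrite ler1n.
have -> : m%:R * (4 * m)%:R^-1 ^+ 2 = (1 / 4) ^+ 2 * m%:R^-1 :> R.
  by field; rewrite pnatr_eq0 -lt0n.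
by rewrite ler_piMr ?sqr_ge0// invf_le1// ltr0n.
Qed.

(** Write a unit vector as [w + y] with [w] on the scaled grid, [norm2 w <= 5/4] and
    [norm2 y <= 1/4]. The least bound [c] then satisfies [c <= 25/16 q + (1/4 + 5/16) c], so
    [c <= 25/7 q]. *)
Lemma grid_opbound m (E : 'M[R]_m) q : E^T = E -> 0 <= q ->
  (forall f, `|bform E (grid_row f) (grid_row f)| <= q * norm2 (grid_row f) ^+ 2) ->
  opbound E (4 * q).
Proof.
move=> sE q0 hf; have [c [hc cmin]] := opbound_min E.
have c0 : 0 <= c by case: hc.
have key x : norm2 x = 1 -> `|bform E x x| <= 25 / 16 * q + 9 / 16 * c.
  move=> x1; have [f hx] := grid_approx x1.
  set w := _ *: grid_row f in hx; pose y := x - w.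
  have w54 : norm2 w <= 5 / 4.
    have -> : w = x - y by rewrite /y opprB addrC subrK.
    by apply: (le_trans (ler_norm2B _ _)); rewrite x1; move: hx; rewrite -/y; lra.
  have hw : `|bform E w w| <= q * norm2 w ^+ 2.
    rewrite /w bformZl bformZr norm2Z exprMn real_normK ?num_real//.
    rewrite mulrA -expr2 normrM ger0_norm ?sqr_ge0// mulrCA.
    by rewrite ler_wpM2l ?sqr_ge0.
  have -> : bform E x x = bform E w w + bform E y x + bform E w y.
    have xE : x = w + y by rewrite /y addrC subrK.
    by rewrite {1}xE bformDl {1}xE bformDr; ring.
  have h1 := opbound_bform y x hc; have h2 := opbound_bform w y hc.
  have h3 := ler_normD (bform E w w + bform E y x) (bform E w y).
  have h4 := ler_normD (bform E w w) (bform E y x).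
  have wpos := norm2_ge0 w; have ypos := norm2_ge0 y.
  have g1 : q * norm2 w ^+ 2 <= q * (25 / 16).
    by rewrite ler_wpM2l//; move: wpos w54; nra.
  have g2 : c * norm2 y * norm2 x <= c * (1 / 4) by rewrite x1 mulr1 ler_wpM2l.
  have g3 : c * norm2 w * norm2 y <= c * (5 / 16).
    by rewrite -mulrA ler_wpM2l//; move: wpos w54 hx ypos; rewrite -/y; nra.
  by move: h1 h2 h3 h4 hw g1 g2 g3; lra.
have hb : opbound E (25 / 16 * q + 9 / 16 * c).
  apply: opbound_sym => // [|x]; first by move: q0 c0; lra.
  have [->|x0] := eqVneq x 0.
    by rewrite bform_dotl mul0mx /dotv mul0mx mxE normr0 norm20 expr0n mulr0.
  have px := norm2_gt0 x0.
  have := key ((norm2 x)^-1 *: x).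
  rewrite norm2Z gtr0_norm ?invr_gt0// mulVf ?gt_eqF// => /(_ erefl).
  rewrite bformZl bformZr mulrA -invfM normrM gtr0_norm ?invr_gt0 ?mulr_gt0//.
  by rewrite [leLHS]mulrC ler_pdivrMr ?mulr_gt0.
by apply: opbound_le hc; have := cmin _ hb; move: q0; lra.
Qed.

End GridNet.

Lemma bform_delta (R : realType) m n (M : 'M[R]_(m, n)) i j :
  bform M (delta_mx 0 i) (delta_mx 0 j) = M i j.
Proof. by rewrite /bform -rowE trmx_delta -colE !mxE. Qed.

Lemma norm2inf_le (R : realType) m q (N : 'M[R]_(m, q)) c : 0 <= c ->
  (forall a, norm2 (row a N) <= c) -> norm2inf N <= c.
Proof.
move=> c0 h; rewrite /norm2inf; elim/big_ind: _ => // [x y hx hy].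
by rewrite ge_max hx hy.
Qed.

(** * Restriction to the support and extension by zero *)

Section Selection.
Variables (R : realType) (p : nat) (J : {set 'I_p}).

Definition selmx : 'M[R]_(#|J|, p) := \matrix_(a, i) (i == enum_val a)%:R.

Lemma mul_selmx q (M : 'M[R]_(p, q)) a j : (selmx *m M) a j = M (enum_val a) j.
Proof.
rewrite mxE (bigD1 (enum_val a))//= mxE eqxx mul1r big1 ?addr0// => i ia.
by rewrite mxE (negPf ia) mul0r.
Qed.

Lemma row_selmx q (M : 'M[R]_(p, q)) a : row a (selmx *m M) = row (enum_val a) M.
Proof. by apply/rowP => j; rewrite mxE mul_selmx mxE. Qed.

Lemma selmx_trK : selmx *m selmx^T = 1%:M.
Proof.
apply/matrixP => a b; rewrite mul_selmx !mxE.
by rewrite (inj_eq enum_val_inj).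
Qed.

Lemma principal_submxE (M : 'M[R]_p) : principal_submx M J = selmx *m M *m selmx^T.
Proof.
apply/matrixP => a b; rewrite -mulmxA mul_selmx -[M *m _]trmxK trmx_mul trmxK.
by rewrite [RHS]mxE mul_selmx !mxE.
Qed.

Lemma selmx_tr_row q (N : 'M[R]_(#|J|, q)) i (iJ : i \in J) :
  row i (selmx^T *m N) = row (enum_rank_in iJ i) N.
Proof.
apply/rowP => j; rewrite !mxE (bigD1 (enum_rank_in iJ i))//= !mxE.
rewrite enum_rankK_in// eqxx mul1r big1 ?addr0// => a ai.
rewrite !mxE; case: eqP => [e|_]; last by rewrite mul0r.
have ea := etrans (congr1 (enum_rank_in iJ) e) (enum_valK_in iJ a).
by move: ai; rewrite ea eqxx.
Qed.

Lemma selmx_tr_row0 q (N : 'M[R]_(#|J|, q)) i : i \notin J -> row i (selmx^T *m N) = 0.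
Proof.
move=> iJ; apply/rowP => j; rewrite !mxE big1// => a _; rewrite !mxE.
case: eqP => [e|_]; last by rewrite mul0r.
by move: iJ; rewrite e enum_valP.
Qed.

Lemma selmx_supported q (M : 'M[R]_(p, q)) :
  (forall i, i \notin J -> row i M = 0) -> selmx^T *m (selmx *m M) = M.
Proof.
move=> M0; apply/row_matrixP => i; have [iJ|iJ] := boolP (i \in J).
  by rewrite selmx_tr_row row_selmx enum_rankK_in.
by rewrite selmx_tr_row0// M0.
Qed.

Lemma norm2inf_selmx q (N : 'M[R]_(#|J|, q)) c : 0 <= c ->
  (forall a, norm2 (row a N) <= c) -> norm2inf (selmx^T *m N) <= c.
Proof.
move=> c0 h; apply: norm2inf_le => // i.
have [iJ|iJ] := boolP (i \in J); first by rewrite selmx_tr_row.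
by rewrite selmx_tr_row0// norm20.
Qed.

End Selection.

(** * Deterministic recovery from quadratic form bounds *)

Section SparseRecovery.
Variables (R : realType) (p k : nat) (Sigma : 'M[R]_p) (lam : seq R).
Variables (U : 'M[R]_(p, k)) (J : {set 'I_p}).
Hypotheses (psdS : psd Sigma) (eigS : ordered_eigenvalues Sigma lam).
Hypotheses (k_gt0 : (0 < k)%N) (k_lt : (k < p)%N).
Hypotheses (leadU : leading_eigenvectors Sigma lam U).
Hypothesis suppU : forall i, i \notin J -> row i U = 0.
Let lk := eigval lam k.
Hypotheses (lk_gt0 : 0 < lk) (gap : eigval lam k.+1 <= lk / 2).

Let I := selmx R J.
Let UJ : 'M[R]_(#|J|, k) := I *m U.
Let l : 'rV[R]_k := \row_(j < k) eigval lam j.+1.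
Let S : 'M[R]_#|J| := principal_submx Sigma J.

Lemma spectral_upper x : bform Sigma x x <= eigval lam 1 * norm2 x ^+ 2.
Proof.
apply: (@bform_complement _ _ 0 Sigma lam (0 : 'M[R]_(p, 0)) x) => //.
- by case: psdS.
- by split; apply/matrixP => i j; [case: i|case: j].
- by apply/matrixP => i [].
Qed.

Lemma eigval_ge0 j : (j < p)%N -> 0 <= eigval lam j.+1.
Proof.
move=> jp; have : root (char_poly Sigma) (eigval lam j.+1).
  case: eigS => _ ->; rewrite root_prod_XsubC mem_nth//.
  by rewrite (size_ordered_eigenvalues eigS).
rewrite -eigenvalue_root_char => /eigenvalueP[x xS x0].
have [_ /(_ x)] := psdS; rewrite xS -scalemxAl mxE -/(dotv x x) -sqr_norm2.
by rewrite pmulr_lge0// exprn_gt0// norm2_gt0.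
Qed.

(* Scaled to have norm at most 1; by polarization the quadratic forms at the
   [probe] vectors control the entries required by [eigenvector_perturbation]. *)
Definition entry_probe (i : 'I_#|J|) (j : 'I_k) : 'rV[R]_#|J| :=
  (lk / 2) *: row i (resolvent S UJ (l 0 j)).

Definition probe (x : 'I_#|J| * 'I_k * bool) : 'rV[R]_p :=
  (entry_probe x.1.1 x.1.2 + (-1) ^+ x.2 *: row x.1.2 UJ^T) *m I.

(** The grid and probe vectors depend on [Sigma], [U] and [J] but not on [Shat], which is what later
    permits a union bound. Since [U] is supported on [J], its restriction is an orthonormal family
    of eigenvectors of the principal submatrix, so the perturbation bound applies in dimension
    [#|J|]. *)
Lemma refit_recovery (Shat : 'M[R]_p) (Ut : 'M[R]_(p, k)) (q q' : R) :
  Shat^T = Shat -> refit Shat J Ut -> 0 <= q -> 0 <= q' -> 4 * q <= lk / 5 ->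
  (forall f, `|bform (Shat - Sigma) (grid_row R f *m I) (grid_row R f *m I)| <=
     q * norm2 (grid_row R f *m I) ^+ 2) ->
  (forall x, `|bform (Shat - Sigma) (probe x) (probe x)| <= q' * norm2 (probe x) ^+ 2) ->
  exists W : 'M[R]_k, orthogonal_mx W /\
    norm2inf (Ut - U *m W) <=
      Num.sqrt k%:R * (2 * q' / lk) + 40 * (4 * q / lk) ^+ 2.
Proof.
move=> symSh [[lh [V [eigSh [VV eigV] rowV]]] Ut0] q0 q'0 qle hgrid hprobe.
have [symS psd0] := psdS; have [UU eigU] := leadU.
have II : I *m I^T = 1%:M := selmx_trK R J.
have IU : I^T *m UJ = U := selmx_supported suppU.
have SE : S = I *m Sigma *m I^T := principal_submxE J Sigma.
pose E : 'M[R]_#|J| := I *m (Shat - Sigma) *m I^T.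
have SEh : S + E = principal_submx Shat J.
  by rewrite principal_submxE /E SE mulmxBr mulmxBl addrC subrK.
have symSJ : S^T = S by rewrite SE !trmx_mul trmxK symS mulmxA.
have symE : E^T = E.
  by rewrite /E !trmx_mul trmxK linearB/= symS symSh mulmxA.
have UJUJ : UJ^T *m UJ = 1%:M by rewrite (_ : UJ^T = U^T *m I^T) -?mulmxA ?IU// trmx_mul.
have eigUJ : S *m UJ = UJ *m diag_mx l.
  by rewrite SE -[LHS]mulmxA IU -[LHS]mulmxA eigU mulmxA.
have lk_le j : lk <= l 0 j.
  have h : (j <= k.-1 < p)%N.
    by have := ltn_ord j; move: k_gt0 k_lt; lia.
  by have := eigval_anti eigS h; rewrite prednK// mxE.
have normI x : norm2 (x *m I) = norm2 x by exact: isometry_norm2.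
have bS x : bform S x x = bform Sigma (x *m I) (x *m I) by rewrite SE bform_mul.
have bE x : bform E x x = bform (Shat - Sigma) (x *m I) (x *m I).
  exact: bform_mul.
have compl_ge0 x : x *m UJ = 0 -> 0 <= bform S x x.
  by move=> _; rewrite bS; exact: psd0.
have compl_le x : x *m UJ = 0 -> bform S x x <= eigval lam k.+1 * norm2 x ^+ 2.
  move=> xU; rewrite bS -normI; apply: (bform_complement symS eigS leadU).
  by rewrite -mulmxA.
have b0 : 0 <= eigval lam k.+1 by exact: eigval_ge0.
have hE : opbound E (4 * q).
  by apply: grid_opbound => // f; rewrite bE -normI.
have UJn j : norm2 (row j UJ^T) = 1.
  by rewrite rowE isometry_norm2 ?norm2_delta// trmxK.
have lh_ge j : lk - 4 * q <= (\row_(j < k) eigval lh j.+1) 0 j.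
  rewrite mxE; apply: (weyl_lower _ eigSh (conj VV eigV) UJUJ).
    by rewrite -SEh linearD/= symSJ symE.
  move=> y; rewrite -SEh bformD.
  have ny : norm2 (y *m UJ^T) = norm2 y by rewrite isometry_norm2// trmxK.
  have := opbound_bform (y *m UJ^T) (y *m UJ^T) hE.
  rewrite ny ler_norml -mulrA -expr2 => /andP[hEl _].
  have : lk * norm2 y ^+ 2 <= bform S (y *m UJ^T) (y *m UJ^T).
    rewrite -bform_mul trmxK -mulmxA eigUJ mulmxA UJUJ mul1mx.
    rewrite sqr_norm2 bform_dotl !dotvE mulr_sumr; apply: ler_sum => i _.
    rewrite mul_mx_diag mxE mulrAC [leRHS]mulrC ler_wpM2r//.
    by rewrite -expr2 sqr_ge0.
  by move: hEl; lra.
have entry i j : `|(resolvent S UJ (l 0 j) *m E *m UJ) i j| <= 2 * q' / lk.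
  pose r := row i (resolvent S UJ (l 0 j)); pose u := row j UJ^T.
  have -> : (resolvent S UJ (l 0 j) *m E *m UJ) i j = bform E r u.
    by rewrite /r /u !rowE -bform_mul trmxK bform_delta.
  have hres := opbound_resolvent symSJ UJUJ lk_gt0 b0 gap compl_ge0 compl_le (lk_le j).
  have rn : norm2 (entry_probe i j) <= 1.
    rewrite /entry_probe norm2Z gtr0_norm ?divr_gt0//.
    have l20 : 0 <= lk / 2 by rewrite divr_ge0// ltW.
    apply: (le_trans (ler_wpM2l l20 (opbound_row i hres))).
    by rewrite le_eqVlt; apply/orP; left; apply/eqP; field; rewrite gt_eqF.
  have pb (b : bool) : `|bform E (entry_probe i j + (-1) ^+ b *: u)
      (entry_probe i j + (-1) ^+ b *: u)| <= q' * norm2 (entry_probe i j + (-1) ^+ b *: u) ^+ 2.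
    by rewrite bE -normI; exact: (hprobe (i, j, b)).
  (* The two probes have squared norms adding up to at most 4. Undoing the scaling by [lk / 2] then
     gives [2 * q' / lk]. *)
  have : `|4%:R * bform E (entry_probe i j) u| <= 4 * q'.
    move: (entry_probe i j) rn pb => a0 rn pb.
    rewrite bform_polar//; have := pb false; have := pb true.
    rewrite expr0 expr1 scale1r scaleN1r => h1 h2.
    apply: (le_trans (ler_normB _ _)); apply: (le_trans (lerD h2 h1)).
    rewrite -mulrDr [leRHS]mulrC ler_wpM2l// -[- u]scaleN1r.
    rewrite !sqr_norm2 !(dotvDl, dotvDr, dotvZl, dotvZr) -!sqr_norm2 (UJn j).
    have : norm2 a0 ^+ 2 <= 1 by rewrite expr_le1 ?norm2_ge0.
    rewrite (dotvC u); lra.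
  rewrite normrM ger0_norm// ler_pM2l// /entry_probe bformZl normrM.
  rewrite gtr0_norm ?divr_gt0// -/r => h.
  by rewrite ler_pdivlMr//; move: h; lra.
have [||W [oW hW]] := eigenvector_perturbation symSJ UJUJ eigUJ lk_le lk_gt0 b0 gap
  compl_ge0 compl_le VV _ lh_ge hE qle _ entry.
- by rewrite SEh.
- by rewrite divr_ge0 ?mulr_ge0// ltW.
exists W; split=> //.
have -> : Ut - U *m W = I^T *m (V - UJ *m W).
  rewrite mulmxBr mulmxA IU; congr (_ - _).
  apply/row_matrixP => i; have [iJ|iJ] := boolP (i \in J).
    by rewrite selmx_tr_row -rowV enum_rankK_in.
  by rewrite selmx_tr_row0// Ut0.
apply: norm2inf_selmx => //.
by rewrite addr_ge0// mulr_ge0 ?sqrtr_ge0 ?sqr_ge0// divr_ge0 ?mulr_ge0// ltW.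
Qed.

End SparseRecovery.

(** * Product rule for independent variables *)

Section ProductRule.
Context d (T : measurableType d) (R : realType) (P : probability T R).
Import HBNNSimple.

Lemma integral_nnsfun_comp (g h : T -> R) (phi : {nnsfun R >-> R}) :
  measurable_fun setT g -> measurable_fun setT h -> (forall w, 0 <= h w) ->
  let s := fset_set (phi @` setT) in
  (\int[P]_w (phi (g w) * h w)%:E =
   \sum_(i < #|`s|) (s`_i)%:E *
     \int[P]_w (\1_(phi @^-1` [set s`_i]) (g w) * h w)%:E)%E.
Proof.
move=> mg mh h0 s.
have s0 (i : 'I_#|`s|) : 0 <= s`_i.
  have : s`_i \in s by exact: mem_nth.
  by rewrite in_fset_set// inE => -[x _ <-].
have mi (A : set R) : measurable A -> measurable_fun setT (fun w => (\1_A (g w) * h w)%:E).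
  move=> mA; apply/measurable_EFinP; apply: measurable_funM => //.
  by apply: (measurableT_comp _ mg); exact: measurable_indic.
have mA (i : 'I_#|`s|) : measurable (phi @^-1` [set s`_i]).
  by rewrite -[X in measurable X]setTI; exact: measurable_funPT.
transitivity (\int[P]_w (\sum_(i < #|`s|)
    (s`_i)%:E * (\1_(phi @^-1` [set s`_i]) (g w) * h w)%:E))%E.
  apply: eq_integral => w _; rewrite (fimfunEord phi) mulr_suml -sumEFin.
  by apply: eq_bigr => i _; rewrite -mulrA EFinM.
rewrite ge0_integral_sum//.
- by apply: eq_bigr => i _; rewrite ge0_integralZl_EFin//;
    [move=> w _; rewrite lee_fin mulr_ge0|exact: mi].
- by move=> i; apply: measurable_funeM; exact: mi.
- by move=> i w _; rewrite mule_ge0// lee_fin// mulr_ge0.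
Qed.

(** The hypothesis says that the measures with densities [h1] and [h2] have the same image under
    [g]; monotone approximation of the identity by simple functions carries this to the integral of
    [g]. *)
Lemma ge0_integral_mul_ext (g h1 h2 : T -> R) :
  measurable_fun setT g -> measurable_fun setT h1 -> measurable_fun setT h2 ->
  (forall w, 0 <= g w) -> (forall w, 0 <= h1 w) -> (forall w, 0 <= h2 w) ->
  (forall A, measurable A -> (\int[P]_w (\1_A (g w) * h1 w)%:E =
                              \int[P]_w (\1_A (g w) * h2 w)%:E)%E) ->
  (\int[P]_w (g w * h1 w)%:E = \int[P]_w (g w * h2 w)%:E)%E.
Proof.
move=> mg mh1 mh2 g0 h10 h20 eqA.
have mD : measurable (`[0, +oo[%classic : set R) by exact: measurable_itv.
have mE : measurable_fun (`[0, +oo[%classic : set R) (@EFin R).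
  by apply/measurable_EFinP; exact: measurable_id.
pose phi := nnsfun_approx mD mE.
have phi_cvg w : EFin (phi n (g w)) @[n --> \oo] --> (g w)%:E.
  apply: (cvg_nnsfun_approx mD mE); last by rewrite /= in_itv/= andbT.
  by move=> x; rewrite /= in_itv/= andbT lee_fin.
have key (h : T -> R) : measurable_fun setT h -> (forall w, 0 <= h w) ->
  (\int[P]_w (g w * h w)%:E = limn (fun n => \int[P]_w (phi n (g w) * h w)%:E))%E.
  move=> mh h0; rewrite -monotone_convergence//.
  - apply: eq_integral => w _; apply/esym/cvg_lim => //.
    under eq_fun do rewrite EFinM.
    by rewrite EFinM; apply: cvgeZr => //; exact: phi_cvg.
  - move=> n; apply/measurable_EFinP; apply: measurable_funM => //.
    exact: (measurableT_comp _ mg).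
  - by move=> n w _; rewrite lee_fin mulr_ge0.
  - move=> w _ m n mn; rewrite lee_fin ler_wpM2r//.
    by have /lefP := nd_nnsfun_approx mD mE mn; exact.
rewrite !key//; congr (limn _); apply/funext => n.
rewrite !integral_nnsfun_comp//; apply: eq_bigr => i _; rewrite eqA//.
Qed.

(** Hybrid induction: [f n B] keeps the first [n] variables and puts indicators of arbitrary sets in
    the other places. At [n = 0] this is the independence hypothesis; each step trades one indicator
    for its variable. *)
Lemma indep_integral_prod m (g : 'I_m -> T -> R) :
  (forall i, measurable_fun setT (g i)) -> (forall i w, 0 <= g i w) ->
  (forall i, (\int[P]_w (g i w)%:E < +oo)%E) ->
  (forall B : 'I_m -> set R, (forall i, measurable (B i)) ->
    P (\bigcap_(i in [set: 'I_m]) (g i @^-1` B i)) =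
    (\prod_(i < m) P (g i @^-1` B i))%E) ->
  (\int[P]_w (\prod_(i < m) g i w)%:E = \prod_(i < m) \int[P]_w (g i w)%:E)%E.
Proof.
move=> mg g0 goo indep.
pose f n (B : 'I_m -> set R) (i : 'I_m) w : R :=
  if (i < n)%N then g i w else \1_(B i) (g i w).
have mf n B i : (forall i, measurable (B i)) -> measurable_fun setT (f n B i).
  move=> mB; rewrite /f; case: (i < n)%N => //.
  have mI : measurable_fun setT (\1_(B i) : R -> R) by exact: measurable_indic.
  exact: (measurableT_comp mI (mg i)).
have f0 n B i w : 0 <= f n B i w by rewrite /f; case: ifP.
have intI B i : measurable B -> (\int[P]_w (\1_B (g i w))%:E = P (g i @^-1` B))%E.
  move=> mB; transitivity (\int[P]_w (\1_(g i @^-1` B) w)%:E)%E.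
    by apply: eq_integral => w _; rewrite !indicE.
  by rewrite integral_indic ?setIT// -[X in measurable X]setTI; exact: mg.
have foo n B i : (forall i, measurable (B i)) -> (\int[P]_w (f n B i w)%:E \is a fin_num)%E.
  move=> mB; rewrite ge0_fin_numE; last by apply: integral_ge0 => w _; rewrite lee_fin.
  rewrite /f; case: (i < n)%N => //; rewrite intI//.
  by rewrite (le_lt_trans (probability_le1 _ _)) ?ltry// -[X in measurable X]setTI; exact: mg.
suff claim n B : (n <= m)%N -> (forall i, measurable (B i)) ->
    (\int[P]_w (\prod_(i < m) f n B i w)%:E = \prod_(i < m) \int[P]_w (f n B i w)%:E)%E.
  have := claim m (fun=> setT) (leqnn m) (fun=> measurableT).
  rewrite /f; under eq_integral do under eq_bigr do rewrite ltn_ord.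
  by under [in RHS]eq_bigr do (under eq_integral do rewrite ltn_ord).
elim: n B => [|n IH] B nm mB.
  rewrite /f /=; under [in RHS]eq_bigr do rewrite intI//.
  rewrite -indep//.
  transitivity (\int[P]_w
      (\1_(\bigcap_(i in [set: 'I_m]) (g i @^-1` B i)) w)%:E)%E; last first.
    rewrite integral_indic ?setIT//; apply: fin_bigcap_measurable => // i _.
    by rewrite -[X in measurable X]setTI; exact: mg.
  apply: eq_integral => w _; congr EFin; rewrite indicE.
  have [/set_mem h|h] := boolP (w \in _).
    by rewrite big1// => i _; rewrite indicE mem_set//; exact: h.
  have : exists i, ~ B i (g i w).
    by apply/existsNP => h'; move/negP: h; apply; apply/mem_set => i _; exact: h'.
  move=> [i Bi]; rewrite (bigD1 i)//= indicE memNset ?mul0r//.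
pose i0 := Ordinal nm.
pose B' A (i : 'I_m) := if i == i0 then A else B i.
pose h w := \prod_(i < m | i != i0) f n.+1 B i w.
(* Finiteness of the integrals makes [c] a real constant, so that [ge0_integral_mul_ext] can compare
   the product [h] of the other factors with it. *)
pose c := \prod_(i < m | i != i0) fine (\int[P]_w (f n.+1 B i w)%:E)%E.
have h0 w : 0 <= h w by apply: prodr_ge0 => i _.
have mh : measurable_fun setT h.
  by rewrite /h; under eq_fun do rewrite -big_filter; apply: measurable_prod => i _; exact: mf.
have c0 : 0 <= c.
  by apply: prodr_ge0 => i _; rewrite fine_ge0// integral_ge0// => w _; rewrite lee_fin.
have cE : c%:E = (\prod_(i < m | i != i0) \int[P]_w (f n.+1 B i w)%:E)%E.
  rewrite /c (big_morph EFin EFinM erefl); apply: eq_bigr => i _.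
  by rewrite fineK// foo.
have fB' A i : i != i0 -> f n (B' A) i = f n.+1 B i.
  move=> ii0; apply/funext => w; rewrite /f /B' (negPf ii0) ltnS.
  by rewrite [(i <= n)%N]leq_eqVlt -[X in X || _]/(i == i0) (negPf ii0).
have fi0 A w : f n (B' A) i0 w = \1_A (g i0 w) by rewrite /f /B' eqxx ltnn.
have fi0S w : f n.+1 B i0 w = g i0 w by rewrite /f ltnSn.
have ext : (\int[P]_w (g i0 w * h w)%:E = \int[P]_w (g i0 w * c)%:E)%E.
  apply: ge0_integral_mul_ext => // A mA.
  have mB' i : measurable (B' A i) by rewrite /B'; case: ifP.
  have := IH (B' A) (ltnW nm) mB'; rewrite (bigD1 i0)//=.
  have -> : (\int[P]_w (f n (B' A) i0 w)%:E = \int[P]_w (\1_A (g i0 w))%:E)%E.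
    by apply: eq_integral => w _; rewrite fi0.
  under [in RHS]eq_bigr => i ii0 do rewrite fB'//.
  rewrite -cE => e.
  transitivity (\int[P]_w (\prod_(i < m) f n (B' A) i w)%:E)%E.
    apply: eq_integral => w _; rewrite (bigD1 i0)//= fi0; congr (_ * _)%:E.
    by apply: eq_bigr => i ii0; rewrite fB'.
  rewrite e -ge0_integralZr//.
  apply/measurable_EFinP.
  have mI : measurable_fun setT (\1_A : R -> R) by exact: measurable_indic.
  exact: (measurableT_comp mI (mg i0)).
rewrite [RHS](bigD1 i0)//= -cE.
have -> : (\int[P]_w (f n.+1 B i0 w)%:E = \int[P]_w (g i0 w)%:E)%E.
  by apply: eq_integral => w _; rewrite fi0S.
transitivity (\int[P]_w (g i0 w * h w)%:E)%E.
  by apply: eq_integral => w _; rewrite (bigD1 i0)//= fi0S.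
rewrite ext; under eq_integral do rewrite EFinM.
by rewrite ge0_integralZr//; [exact/measurable_EFinP|move=> w _; rewrite lee_fin].
Qed.

End ProductRule.

(** * Concentration of quadratic forms *)

Section ExpEstimates.
Variable R : realType.

Lemma expR_le_quadratic (x : R) : expR x <= 1 + x + x ^+ 2 * expR `|x|.
Proof.
have [x0|x0] := leP 0 x.
  rewrite ger0_norm//.
  have h : expR x - 1 <= x * expR x.
    have := expR_ge1Dx (- x); rewrite expRN => h.
    have : expR x * (1 - x) <= 1.
      by rewrite mulrC -ler_pdivlMr ?expR_gt0// div1r.
    lra.
  have : x * (expR x - 1) <= x * (x * expR x) by rewrite ler_wpM2l.
  by move: h; rewrite expr2; lra.
suff key (y : R) : 0 < y -> expR (- y) <= 1 - y + y ^+ 2 * expR y.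
  by have := key (- x); rewrite oppr_gt0 => /(_ x0); rewrite ltr0_norm// !opprK sqrrN.
move=> y0; have e1 := expR_ge1Dx y.
have h1 : expR (- y) <= 1 - y + y ^+ 2.
  rewrite expRN; apply: (@le_trans _ _ (1 + y)^-1).
    by rewrite lef_pV2 ?posrE ?expR_gt0 ?addr_gt0.
  rewrite -div1r ler_pdivrMr ?addr_gt0//.
  have : 0 < y ^+ 3 by exact: exprn_gt0.
  by lra.
have : y ^+ 2 <= y ^+ 2 * expR y by rewrite ler_peMr ?sqr_ge0//; lra.
lra.
Qed.

Lemma sqr_le_expR (h : R) : 0 <= h -> h ^+ 2 <= 2 * expR h.
Proof.
by move=> h0; have := expR_ge1Dxn 1 h0; rewrite (_ : 2`!%:R = 2)//; lra.
Qed.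

Lemma expR_half_le : expR (1 / 2) <= 2 :> R.
Proof.
have := expR_ge1Dx (- (1 / 2) : R); rewrite expRN => h.
have e0 := expR_gt0 (1 / 2 : R).
have : (1 - 1 / 2) * expR (1 / 2) <= 1 :> R by rewrite -ler_pdivlMr// [leRHS]div1r.
lra.
Qed.

End ExpEstimates.

(** * Exponential moments of one variable *)

Section SingleVariable.
Context d (T : measurableType d) (R : realType) (P : probability T R).

(** Integrates a pointwise bound whose linear term may have any sign; the domination by [k * G]
    makes [X] integrable. *)
Lemma affine_integral_le (f X G : T -> R) (x g a b c k : R) :
  measurable_fun setT f -> measurable_fun setT X -> measurable_fun setT G ->
  (forall w, 0 <= f w) -> (forall w, 0 <= G w) -> 0 <= c ->
  (forall w, `|X w| <= k * G w) ->
  (\int[P]_w (X w)%:E = x%:E)%E -> (\int[P]_w (G w)%:E <= g%:E)%E ->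
  (forall w, f w <= a + b * X w + c * G w) ->
  (\int[P]_w (f w)%:E <= (a + b * x + c * g)%:E)%E.
Proof.
move=> mf mX mG f0 G0 c0 XG iX iG fle.
have intG : P.-integrable setT (EFin \o G).
  apply/integrableP; split; first exact/measurable_EFinP.
  under eq_integral do rewrite /= ger0_norm//.
  by rewrite (le_lt_trans iG)// ltry.
have intX : P.-integrable setT (EFin \o X).
  apply: le_integrable (integrableZl measurableT k intG) => //.
    exact/measurable_EFinP.
  by move=> w _ /=; rewrite lee_fin (le_trans (XG w))// ler_norm.
have intA : P.-integrable setT (EFin \o (cst a : T -> R)).
  exact: finite_measure_integrable_cst.
have intbX := integrableZl measurableT b intX.
have intcG := integrableZl measurableT c intG.
have intaX := integrableD measurableT intA intbX.
apply: (@le_trans _ _ (\int[P]_w ((a%:E + b%:E * (X w)%:E) + c%:E * (G w)%:E))%E).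
  apply: ge0_le_integral => //.
  - by move=> w _; rewrite lee_fin.
  - exact/measurable_EFinP.
  - apply: emeasurable_funD; first by case/integrableP: intaX.
    by case/integrableP: intcG.
  - by move=> w _; rewrite -!EFinM -!EFinD lee_fin.
rewrite (integralD measurableT intaX intcG) (integralD measurableT intA intbX).
rewrite (integralZl measurableT intX) (integralZl measurableT intG) iX.
rewrite [X in (X + _ + _)%E](_ : _ = a%:E); last first.
  rewrite -[LHS]/(\int[P]_w cst a%:E w)%E integral_cst//.
  by rewrite -[RHS]mule1; congr (_ * _)%E; exact: probability_setT.
rewrite !EFinD !EFinM; apply: leeD => //; apply: lee_wpmul2l => //.
Qed.

(** Put [nu = mu t] and [W = Y / t]. For [|nu| <= 1/2] the linear Taylor term integrates to 0 and
    the remainder is at most [4 nu^2 exp (W^2)], whose integral is at most [8 nu^2]. For larger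
    [nu], [nu W <= nu^2 + W^2] and the factor 2 is absorbed by [exp (4 nu^2)]. *)
Lemma mgf_centered (Y : T -> R) (t : R) : measurable_fun setT Y -> 0 < t ->
  (\int[P]_w (expR (Y w ^+ 2 / t ^+ 2))%:E <= 2%:E)%E ->
  (\int[P]_w (Y w)%:E = 0)%E ->
  forall mu, (\int[P]_w (expR (mu * Y w))%:E <= (expR (8 * t ^+ 2 * mu ^+ 2))%:E)%E.
Proof.
move=> mY t0 hG EY mu.
have mG : measurable_fun setT (fun w => expR (Y w ^+ 2 / t ^+ 2)).
  apply: measurableT_comp => //; apply: measurable_funM => //.
  exact: measurable_funX.
have mf : measurable_fun setT (fun w => expR (mu * Y w)).
  by apply: measurableT_comp => //; exact: measurable_funM.
pose nu := mu * t.
have WE w : Y w ^+ 2 / t ^+ 2 = (Y w / t) ^+ 2 by rewrite expr_div_n.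
have nuE w : mu * Y w = nu * (Y w / t) by rewrite /nu; field; rewrite gt_eqF.
have YG w : `|Y w| <= t * expR (Y w ^+ 2 / t ^+ 2).
  rewrite -ler_pdivrMl// WE; set W := Y w / t.
  have -> : t^-1 * `|Y w| = `|W|.
    by rewrite /W normrM (gtr0_norm (_ : 0 < t^-1)) ?invr_gt0// mulrC.
  have := expR_ge1Dx (W ^+ 2); rewrite -[W ^+ 2]real_normK ?num_real//.
  have := normr_ge0 W; nra.
have [nu2|nu2] := leP `|nu| (1 / 2).
  have h := @affine_integral_le _ _ _ 0 2 1 mu (4 * nu ^+ 2) t mf mY mG
    (fun w => expR_ge0 _) (fun w => expR_ge0 _) _ YG EY hG.
  apply: (le_trans (h _ _)).
  - by rewrite mulr_ge0// sqr_ge0.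
  - move=> w; rewrite nuE WE; set W := Y w / t.
    apply: (le_trans (expR_le_quadratic _)).
    rewrite lerD2l.
    have -> : (nu * W) ^+ 2 * expR `|nu * W| = nu ^+ 2 * (W ^+ 2 * expR `|nu * W|).
      by rewrite exprMn mulrA.
    have -> : 4 * nu ^+ 2 * expR (W ^+ 2) = nu ^+ 2 * (4 * expR (W ^+ 2)) by ring.
    rewrite ler_wpM2l ?sqr_ge0//.
    have a0 := normr_ge0 W.
    have s1 : W ^+ 2 <= 2 * expR (W ^+ 2 / 2).
      have := expR_ge1Dx (W ^+ 2 / 2); have := sqr_ge0 W; lra.
    have s2 : `|nu * W| <= W ^+ 2 / 2 + 1 / 2.
      rewrite normrM -[W ^+ 2]real_normK ?num_real//.
      by have := normr_ge0 nu; nra.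
    have s3 : expR `|nu * W| <= expR (W ^+ 2 / 2) * 2.
      apply: (@le_trans _ _ (expR (W ^+ 2 / 2 + 1 / 2))); first by rewrite ler_expR.
      by rewrite expRD ler_wpM2l ?expR_ge0// expR_half_le.
    have -> : 4 * expR (W ^+ 2) = (2 * expR (W ^+ 2 / 2)) * (expR (W ^+ 2 / 2) * 2).
      have -> : expR (W ^+ 2) = expR (W ^+ 2 / 2) * expR (W ^+ 2 / 2).
        by rewrite -expRD; congr expR; field.
      by ring.
    by apply: ler_pM => //; rewrite ?sqr_ge0 ?expR_ge0.
  - rewrite lee_fin mulr0 addr0.
    apply: (le_trans _ (expR_ge1Dx _)); rewrite /nu exprMn lerD2l.
    by have := sqr_ge0 mu; have := sqr_ge0 t; nra.
have h := @affine_integral_le _ _ _ 0 2 0 0 (expR (nu ^+ 2)) t mf mY mG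
  (fun w => expR_ge0 _) (fun w => expR_ge0 _) (expR_ge0 _) YG EY hG.
apply: (le_trans (h _)).
  move=> w; rewrite nuE WE; set W := Y w / t; rewrite mul0r !add0r -expRD ler_expR.
  by have := sqr_ge0 (nu - W); have := sqr_ge0 nu; have := sqr_ge0 W; nra.
rewrite lee_fin mul0r !add0r.
have q : 1 / 4 <= nu ^+ 2.
  by rewrite -[nu ^+ 2]real_normK ?num_real//; nra.
have e2 : (2 : R) <= expR (4 * nu ^+ 2).
  by apply: le_trans (expR_ge1Dx _); lra.
apply: (@le_trans _ _ (expR (nu ^+ 2) * expR (4 * nu ^+ 2))).
  by rewrite ler_wpM2l ?expR_ge0.
by rewrite -expRD ler_expR /nu exprMn; have := sqr_ge0 mu; have := sqr_ge0 t; nra.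
Qed.

(* [exp(y^2/2)] is dominated by a single term of [2 sum_m exp(-m^2/2) 2 cosh(m y)],
   the one with [m] the integer part of [|y|]. *)
Definition mixture_bound : R := 4 / (1 - expR (- (1 / 4))).

(** The scale [r] is such that [V (m r)^2 = m^2 / 4], half of the weight [m^2 / 2]. The m-th term
    then integrates to at most [4 exp (- m^2 / 4) <= 4 q^m], and the geometric series sums to
    [mixture_bound]. *)
Lemma integral_expR_sqr (Z : T -> R) (V : R) : measurable_fun setT Z -> 0 < V ->
  (forall mu, (\int[P]_w (expR (mu * Z w))%:E <= (expR (V * mu ^+ 2))%:E)%E) ->
  (\int[P]_w (expR ((8 * V)^-1 * Z w ^+ 2))%:E <= mixture_bound%:E)%E.
Proof.
move=> mZ V0 hZ.
pose r := (Num.sqrt (4 * V))^-1.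
have s0 : 0 < Num.sqrt (4 * V) by rewrite sqrtr_gt0 mulr_gt0.
have r2 : r ^+ 2 = (4 * V)^-1 by rewrite /r exprVn sqr_sqrtr// mulr_ge0// ltW.
pose c (m : nat) : R := 2 * expR (- (m%:R ^+ 2 / 2)).
have c0 m : 0 <= c m by rewrite mulr_ge0 ?expR_ge0.
pose u (m : nat) w : R := c m * (expR ((m%:R * r) * Z w) + expR ((- (m%:R * r)) * Z w)).
have u0 m w : 0 <= u m w by rewrite mulr_ge0// addr_ge0 ?expR_ge0.
have me a : measurable_fun setT (fun w => expR (a * Z w)).
  by apply: measurableT_comp => //; exact: measurable_funM.
have mu_ m : measurable_fun setT (EFin \o u m).
  apply/measurable_EFinP; apply: measurable_funM => //.
  exact: measurable_funD.
pose q : R := expR (- (1 / 4)).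
have q01 : 0 <= q < 1 by rewrite expR_ge0/= -expR0 ltr_expR; lra.
have int_u m : (\int[P]_w (u m w)%:E <= (4 * q ^+ m)%:E)%E.
  rewrite /u; under eq_integral do rewrite EFinM EFinD.
  rewrite ge0_integralZl_EFin//; last 2 first.
  - by move=> w _; rewrite adde_ge0// lee_fin expR_ge0.
  - by apply: emeasurable_funD; exact/measurable_EFinP.
  rewrite ge0_integralD//; [|exact/measurable_EFinP..].
  have Vmr : V * (m%:R * r) ^+ 2 = m%:R ^+ 2 / 4.
    by rewrite exprMn r2; field; rewrite gt_eqF.
  apply: (@le_trans _ _ ((c m)%:E *
      ((expR (m%:R ^+ 2 / 4))%:E + (expR (m%:R ^+ 2 / 4))%:E))%E).
    rewrite lee_wpmul2l ?lee_fin// leeD//.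
      by apply: (le_trans (hZ _)); rewrite Vmr.
    by apply: (le_trans (hZ _)); rewrite sqrrN Vmr.
  rewrite -EFinD -EFinM lee_fin /c.
  have ring4 (x y : R) : 2 * x * (y + y) = 4 * (x * y) by ring.
  rewrite ring4 -expRD /q -expRM_natl ler_wpM2l// ler_expR.
  have : (m%:R : R) <= m%:R ^+ 2.
    by case: {Vmr} m => [|m]; rewrite ?expr0n// expr2 ler_peMr// ler1n.
  lra.
have point w : ((expR ((8 * V)^-1 * Z w ^+ 2))%:E <= \sum_(m <oo) (u m w)%:E)%E.
  pose m := Num.truncn `|r * Z w|.
  have mem : ((u m w)%:E <= \sum_(m <oo) (u m w)%:E)%E.
    apply: (@le_trans _ _ (\sum_(0 <= i < m.+1) (u i w)%:E)%E); last first.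
      by apply: nneseries_lim_ge => i _ _; rewrite lee_fin.
    rewrite big_nat_recr//= leeDr//; apply: sume_ge0 => i _; by rewrite lee_fin.
  apply: le_trans mem; rewrite lee_fin.
  have -> : (8 * V)^-1 * Z w ^+ 2 = `|r * Z w| ^+ 2 / 2.
    by rewrite real_normK ?num_real// exprMn r2; field; rewrite gt_eqF.
  have : expR (m%:R * `|r * Z w|) <= expR ((m%:R * r) * Z w) + expR ((- (m%:R * r)) * Z w).
    have [h|h] := leP 0 (r * Z w).
      by rewrite ger0_norm// mulrA lerDl expR_ge0.
    by rewrite ltr0_norm// mulrN mulrA -mulNr lerDr expR_ge0.
  have /andP[h1 h2] := truncn_itv (normr_ge0 (r * Z w)); rewrite -/m -natr1 in h1 h2.
  set y := `|r * Z w| in h1 h2 *.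
  move=> h; apply: (@le_trans _ _ (c m * expR (m%:R * y))); last by rewrite ler_wpM2l.
  (* Since [0 <= y - m < 1], expanding [(y - m)^2 <= 1] gives [y^2 / 2 <= 1/2 - m^2 / 2 + m y]. *)
  rewrite /c; apply: (@le_trans _ _ (expR (1 / 2) * (expR (- (m%:R ^+ 2 / 2)) * expR (m%:R * y)))).
    by rewrite -!expRD ler_expR; nra.
  rewrite -mulrA ler_wpM2r ?mulr_ge0 ?expR_ge0//; exact: expR_half_le.
apply: (@le_trans _ _ (\int[P]_w \sum_(m <oo) (u m w)%:E)%E).
  apply: ge0_le_integral => //.
  - apply/measurable_EFinP; apply: measurableT_comp => //.
    by apply: measurable_funM => //; exact: measurable_funX.
  - apply: ge0_emeasurable_sum => [k w _ _|k _]; last exact: mu_.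
    by rewrite lee_fin.
rewrite integral_nneseries//; last by move=> m w _; rewrite lee_fin.
apply: (@le_trans _ _ (\sum_(m <oo) (4 * q ^+ m)%:E)%E).
  by apply: lee_nneseries => // m _ _; apply: integral_ge0 => w _; rewrite lee_fin.
apply: lime_le.
  by apply: is_cvg_nneseries => m _ _; rewrite lee_fin mulr_ge0// exprn_ge0//; case/andP: q01.
apply: nearW => n; rewrite sumEFin lee_fin.
have /andP[q0 q1] := q01.
have := congr1 (fun f : nat -> R => f n) (@geometric_seriesE R 4 q (negbT (lt_eqF q1))).
rewrite seriesEnat/= => ->; rewrite /mixture_bound -/q ler_wpM2r ?invr_ge0 ?subr_ge0 ?(ltW q1)//.
by rewrite ler_piMr// gerBl exprn_ge0.
Qed.

(** With [H = c (Z^2 + v) / 2], the range of [theta] gives [|theta (Z^2 - v)| <= H]. The Taylor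
    remainder is thus absorbed by [exp (2 H) = exp (c v) exp (c Z^2)], and [c v <= B] because
    [x <= exp x]. *)
Lemma mgf_centered_sqr (Z : T -> R) (c B v : R) : measurable_fun setT Z ->
  0 < c -> (\int[P]_w (expR (c * Z w ^+ 2))%:E <= B%:E)%E ->
  (\int[P]_w (Z w ^+ 2)%:E = v%:E)%E ->
  forall theta, `|theta| <= c / 2 ->
  (\int[P]_w (expR (theta * (Z w ^+ 2 - v)))%:E <=
     (expR (8 * (theta / c) ^+ 2 * B * expR B))%:E)%E.
Proof.
move=> mZ c0 hB hv theta htheta.
have mZ2 : measurable_fun setT (fun w => Z w ^+ 2) by exact: measurable_funX.
have mG : measurable_fun setT (fun w => expR (c * Z w ^+ 2)).
  by apply: measurableT_comp => //; exact: measurable_funM.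
have v0 : 0 <= v by rewrite -lee_fin -hv integral_ge0// => w _; rewrite lee_fin sqr_ge0.
have cv : c * v <= B.
  rewrite -lee_fin (le_trans _ hB)// EFinM -hv -ge0_integralZl_EFin//; last 3 first.
  - by move=> w _; rewrite lee_fin sqr_ge0.
  - exact/measurable_EFinP.
  - exact: ltW.
  apply: ge0_le_integral => //.
  - by move=> w _; rewrite mule_ge0// lee_fin ?sqr_ge0// ltW.
  - by apply: measurable_funeM; exact/measurable_EFinP.
  - exact/measurable_EFinP.
  - move=> w _; rewrite -EFinM lee_fin; apply: le_trans (expR_ge1Dx _).
    by rewrite lerDr.
have B0 : 0 <= B by apply: le_trans cv; rewrite mulr_ge0// ltW.
have mf : measurable_fun setT (fun w => expR (theta * (Z w ^+ 2 - v))).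
  apply: measurableT_comp => //; apply: measurable_funM => //.
  exact: measurable_funB.
apply: (le_trans (@affine_integral_le _ (fun w => Z w ^+ 2) _ v B (1 - theta * v)
  theta (8 * (theta / c) ^+ 2 * expR (c * v)) c^-1 mf mZ2 mG
  (fun w => expR_ge0 _) (fun w => expR_ge0 _) _ _ hv hB _)).
- by rewrite mulr_ge0 ?expR_ge0// mulr_ge0// sqr_ge0.
- move=> w; rewrite ger0_norm ?sqr_ge0// ler_pdivlMl//.
  by apply: le_trans (expR_ge1Dx _); rewrite lerDr.
- move=> w; apply: (le_trans (expR_le_quadratic _)).
  set x := theta * _.
  have -> : 1 - theta * v + theta * Z w ^+ 2 = 1 + x by rewrite /x; ring.
  rewrite lerD2l -[leRHS]mulrA -expRD.
  pose H := c / 2 * (Z w ^+ 2 + v).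
  have Zw := sqr_ge0 (Z w).
  have H0 : 0 <= H by rewrite mulr_ge0 ?divr_ge0 ?addr_ge0// ltW.
  have Zv : `|Z w ^+ 2 - v| <= Z w ^+ 2 + v.
    by rewrite ler_norml; apply/andP; split; lra.
  have xH : `|x| <= H by rewrite /x normrM; apply: ler_pM.
  have -> : c * v + c * Z w ^+ 2 = H + H by rewrite /H; field.
  have x2 : x ^+ 2 <= 4 * (theta / c) ^+ 2 * H ^+ 2.
    have -> : 4 * (theta / c) ^+ 2 * H ^+ 2 = theta ^+ 2 * (Z w ^+ 2 + v) ^+ 2.
      by rewrite /H; field; rewrite gt_eqF.
    rewrite /x exprMn ler_wpM2l ?sqr_ge0// -[X in X <= _]real_normK ?num_real//.
    by rewrite ler_sqr ?nnegrE// addr_ge0.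
  have -> : 8 * (theta / c) ^+ 2 * expR (H + H) =
    (4 * (theta / c) ^+ 2 * (2 * expR H)) * expR H by rewrite expRD; ring.
  apply: ler_pM; rewrite ?sqr_ge0 ?expR_ge0 ?ler_expR//.
  apply: (le_trans x2); rewrite ler_wpM2l ?sqr_le_expR//.
  by rewrite mulr_ge0// sqr_ge0.
- rewrite lee_fin subrK; apply: le_trans (expR_ge1Dx _); rewrite lerD2l.
  rewrite [leRHS]mulrAC ler_wpM2r// ler_wpM2l ?ler_expR//.
  by rewrite mulr_ge0// sqr_ge0.
Qed.

End SingleVariable.

(** * Chernoff bound for sums of independent squares *)

Section Concentration.
Context d (T : measurableType d) (R : realType) (P : probability T R).

(* At [theta = tau / V] and [c = (8 * V)^-1] the exponent in [mgf_centered_sqr]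
   becomes [rate_const * tau ^+ 2]. *)
Definition rate_const : R := 512 * mixture_bound R * expR (mixture_bound R).

Lemma rate_const_ge : 512 <= rate_const.
Proof.
have q1 : expR (- (1 / 4)) < 1 :> R by rewrite expR_lt1; lra.
have q0 := expR_gt0 (- (1 / 4) : R).
have m1 : 1 <= mixture_bound R.
  by rewrite /mixture_bound ler_pdivlMr ?subr_gt0//; lra.
have e1 : 1 <= expR (mixture_bound R) by apply: le_trans (expR_ge1Dx _); lra.
by have := mulr_ege1 m1 e1; rewrite /rate_const -mulrA; lra.
Qed.

Lemma lee_prod_ord m (x y : 'I_m -> \bar R) :
  (forall i, (0 <= x i)%E) -> (forall i, (x i <= y i)%E) ->
  (\prod_(i < m) x i <= \prod_(i < m) y i)%E.
Proof.
move=> x0 xy.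
have [] // : (0 <= \prod_(i < m) x i)%E /\ (\prod_(i < m) x i <= \prod_(i < m) y i)%E.
apply: (big_ind2 (fun a b : \bar R => (0 <= a)%E /\ (a <= b)%E)) => //.
move=> a1 b1 a2 b2 [a10 ab1] [a20 ab2].
by split; [exact: mule_ge0|exact: lee_pmul].
Qed.

Definition product_rule m (Z : 'I_m -> T -> R) : Prop :=
  forall B : 'I_m -> set R, (forall i, measurable (B i)) ->
    P (\bigcap_(i in [set: 'I_m]) (Z i @^-1` B i)) =
    (\prod_(i < m) P (Z i @^-1` B i))%E.

Lemma product_rule_comp m (Z : 'I_m -> T -> R) (G : 'I_m -> R -> R) :
  (forall i, measurable_fun setT (G i)) -> product_rule Z ->
  product_rule (fun i w => G i (Z i w)).
Proof.
move=> mG indep B mB; apply: (indep (fun i => G i @^-1` B i)) => i.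
by rewrite -[X in measurable X]setTI; exact: mG.
Qed.

Section Chernoff.
Variables (n : nat) (Z : 'I_n -> T -> R) (V v : R).
Hypotheses (mZ : forall i, measurable_fun setT (Z i)) (V0 : 0 < V).
Hypothesis mgfZ : forall i mu,
  (\int[P]_w (expR (mu * Z i w))%:E <= (expR (V * mu ^+ 2))%:E)%E.
Hypothesis EZ2 : forall i, (\int[P]_w (Z i w ^+ 2)%:E = v%:E)%E.
Hypothesis indepZ : product_rule Z.

Let S w := \sum_(i < n) (Z i w ^+ 2 - v).

Lemma measurable_sum_sqr : measurable_fun setT S.
Proof.
apply: measurable_sum => i; apply: measurable_funB => //.
exact: measurable_funX.
Qed.

Lemma chernoff_one_sided (sg u : R) : `|sg| = 1 -> 0 <= u <= 1 ->
  (P [set w | (n%:R * u * V <= sg * S w)%R] <=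
     (expR (- (n%:R * u ^+ 2 / (4 * rate_const))))%:E)%E.
Proof.
move=> sg1 /andP[u0 u1]; have := rate_const_ge; move AE : rate_const => A A512.
have A0 : 0 < A by lra.
(* This [tau] minimizes [A tau^2 - tau u], with value [- u^2 / (4 A)]. The admissible range of
   [theta] amounts to [tau <= 1/16]. *)
pose tau := u / (2 * A); pose theta := sg * tau / V.
have tau0 : 0 <= tau by rewrite divr_ge0// mulr_ge0// ltW.
have tau16 : tau <= 1 / 16.
  have A2 : 0 < 2 * A by lra.
  by rewrite /tau ler_pdivrMr//; lra.
pose g (i : 'I_n) w := expR (theta * (Z i w ^+ 2 - v)).
have mG : measurable_fun setT (fun x : R => expR (theta * (x ^+ 2 - v))).
  apply: measurableT_comp => //; apply: measurable_funM => //.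
  by apply: measurable_funB => //; exact: measurable_funX.
have mg i : measurable_fun setT (g i) by exact: (measurableT_comp mG (mZ i)).
have gle i : (\int[P]_w (g i w)%:E <= (expR (A * tau ^+ 2))%:E)%E.
  have c0 : 0 < (8 * V)^-1 by rewrite invr_gt0 mulr_gt0.
  have := mgf_centered_sqr (mZ i) c0 (integral_expR_sqr (mZ i) V0 (mgfZ i)) (EZ2 i).
  move=> /(_ theta) h; apply: (le_trans (h _)).
    rewrite /theta normrM normrM sg1 mul1r ger0_norm// gtr0_norm ?invr_gt0//.
    have -> : (8 * V)^-1 / 2 = 1 / 16 * V^-1 by field; rewrite gt_eqF.
    by rewrite ler_wpM2r// invr_ge0 ltW.
  rewrite lee_fin ler_expR.
  have -> : (theta / (8 * V)^-1) ^+ 2 = 64 * tau ^+ 2.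
    transitivity (64 * sg ^+ 2 * tau ^+ 2).
      by rewrite /theta; field; rewrite gt_eqF.
    by rewrite -[sg ^+ 2]real_normK ?num_real// sg1 expr1n mulr1.
  by rewrite le_eqVlt; apply/orP; left; apply/eqP; rewrite -AE /rate_const; ring.
have g0 i w : 0 <= g i w by exact: expR_ge0.
have prod_le : (\int[P]_w (\prod_(i < n) g i w)%:E <= (expR (n%:R * (A * tau ^+ 2)))%:E)%E.
  rewrite indep_integral_prod//; last 2 first.
  - by move=> i; rewrite (le_lt_trans (gle i))// ltry.
  - exact: (product_rule_comp (G := fun _ x => expR (theta * (x ^+ 2 - v)))).
  rewrite expRM_natl.
  have -> : (expR (A * tau ^+ 2) ^+ n)%:E = (\prod_(i < n) (expR (A * tau ^+ 2))%:E)%E.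
    by rewrite -(big_morph EFin EFinM erefl) prodr_const card_ord.
  apply: lee_prod_ord => i //.
  by apply: integral_ge0 => w _; rewrite lee_fin.
set D := [set w | _]; have mD : measurable D.
  rewrite -[D]setTI /D; apply: (measurable_fun_le (f := cst _)) => //.
  by apply: measurable_funM => //; exact: measurable_sum_sqr.
have markov : ((expR (tau * (n%:R * u)))%:E * P D <= (expR (n%:R * (A * tau ^+ 2)))%:E)%E.
  apply: le_trans prod_le.
  rewrite -(setIT D) -integral_indic// -ge0_integralZl_EFin ?expR_ge0//; last first.
    by apply/measurable_EFinP; exact: measurable_indic.
  apply: ge0_le_integral => //.
  - by apply: measurable_funeM; apply/measurable_EFinP; exact: measurable_indic.
  - by apply/measurable_EFinP; apply: measurable_prod => i _; exact: mg.
  move=> w _; rewrite -EFinM lee_fin -expR_sum indicE.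
  have [/set_mem Dw|_] := boolP (w \in D); last by rewrite mulr0 expR_ge0.
  rewrite mulr1 ler_expR -mulr_sumr -/(S w) /theta.
  have -> : sg * tau / V * S w = tau * ((sg * S w) / V) by field; rewrite gt_eqF.
  by rewrite ler_wpM2l// ler_pdivlMr.
have e0 := expR_gt0 (tau * (n%:R * u)).
have -> : - (n%:R * u ^+ 2 / (4 * A)) = n%:R * (A * tau ^+ 2) - tau * (n%:R * u).
  by rewrite /tau; field; rewrite gt_eqF.
by rewrite expRB EFinM -[X in (_ <= _ * X)%E]/(_%:E) lee_pdivlMr// muleC.
Qed.

Lemma chernoff_two_sided u : 0 <= u <= 1 ->
  measurable [set w | n%:R * u * V < `|S w|] /\
  (P [set w | (n%:R * u * V < `|S w|)%R] <=
     (2 * expR (- (n%:R * u ^+ 2 / (4 * rate_const))))%:E)%E.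
Proof.
move=> hu; have mS := measurable_sum_sqr.
have mA : measurable [set w | n%:R * u * V < `|S w|].
  have mf : measurable_fun setT (fun w => `|S w|) by exact: measurableT_comp.
  have := mf measurableT _ (measurable_itv `]n%:R * u * V, +oo[).
  rewrite setTI; congr measurable.
  by apply/seteqP; split => w /=; rewrite in_itv/= andbT.
split=> //.
have h1 := chernoff_one_sided (normr1 R) hu.
have h2 := chernoff_one_sided (etrans (normrN1 R) erefl) hu.
set D1 := [set w | _] in h1; set D2 := [set w | _] in h2.
have mD (sg : R) : measurable [set w | n%:R * u * V <= sg * S w].
  rewrite -[X in measurable X]setTI; apply: (measurable_fun_le (f := cst _)) => //.
  exact: measurable_funM.
apply: (@le_trans _ _ (P (D1 `|` D2))).
  apply: le_measure; rewrite ?inE.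
  - exact: mA.
  - by apply: measurableU; exact: mD.
  - move=> w /=; rewrite /D1 /D2/= mul1r mulN1r => /ltW.
    by rewrite ler_normr => /orP[h|h]; [left|right].
apply: (le_trans (measureU2 _ _ _)); [exact: mD|exact: mD|].
by rewrite mulrC mulr_natr mulr2n EFinD leeD.
Qed.

End Chernoff.

(** Independence adds the exponents, so the dimension enters only through [norm2 a]. *)
Lemma mgf_linear_form m (Y : 'I_m -> T -> R) (t : R) (a : 'rV[R]_m) :
  0 < t -> (forall j, measurable_fun setT (Y j)) -> product_rule Y ->
  (forall j, (\int[P]_w (expR (Y j w ^+ 2 / t ^+ 2))%:E <= 2%:E)%E) ->
  (forall j, (\int[P]_w (Y j w)%:E = 0)%E) -> forall mu,
  (\int[P]_w (expR (mu * \sum_j a 0 j * Y j w))%:E <=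
     (expR (8 * t ^+ 2 * norm2 a ^+ 2 * mu ^+ 2))%:E)%E.
Proof.
move=> t0 mY indep hY EY mu.
pose g (j : 'I_m) w := expR (mu * a 0 j * Y j w).
have gle j := mgf_centered (mY j) t0 (hY j) (EY j) (mu * a 0 j).
have mG j : measurable_fun setT (fun x : R => expR (mu * a 0 j * x)).
  by apply: measurableT_comp => //; exact: measurable_funM.
have ge0 j w : 0 <= g j w by exact: expR_ge0.
have -> : (\int[P]_w (expR (mu * \sum_j a 0 j * Y j w))%:E =
           \int[P]_w (\prod_(j < m) g j w)%:E)%E.
  apply: eq_integral => w _; rewrite -expR_sum mulr_sumr.
  by congr (expR _)%:E; apply: eq_bigr => j _; rewrite mulrA.
rewrite indep_integral_prod//; last 3 first.
- by move=> j; exact: (measurableT_comp (mG j) (mY j)).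
- by move=> j; rewrite (le_lt_trans (gle j))// ltry.
- exact: (product_rule_comp (G := fun j x => expR (mu * a 0 j * x))).
apply: (@le_trans _ _ (\prod_(j < m) (expR (8 * t ^+ 2 * (mu * a 0 j) ^+ 2))%:E)%E).
  apply: lee_prod_ord => j; last exact: gle.
  by apply: integral_ge0 => w _; rewrite lee_fin.
have -> : (\prod_(j < m) (expR (8 * t ^+ 2 * (mu * a 0 j) ^+ 2))%:E =
    (\prod_(j < m) expR (8 * t ^+ 2 * (mu * a 0 j) ^+ 2))%:E)%E.
  by rewrite (big_morph EFin EFinM erefl).
rewrite -expR_sum lee_fin ler_expR.
rewrite sqr_norm2 dotvE mulr_sumr mulr_suml le_eqVlt; apply/orP; left; apply/eqP.
by apply: eq_bigr => j _; ring.
Qed.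

End Concentration.

(** * From independent sigma-algebras to the product rule *)

Section SigmaAlgebras.
Context d (T : measurableType d) (R : realType) (P : probability T R).

Lemma independent_sigma_product_rule m (F : 'I_m -> set (set T))
    (Z : 'I_m -> T -> R) : independent_sigma P F ->
  (forall i B, measurable B -> F i (Z i @^-1` B)) -> product_rule P Z.
Proof. by move=> indep FZ B mB; apply: indep => i; exact: FZ. Qed.

Lemma sigma_rv_preimage (Z : T -> R) (B : set R) : measurable B ->
  sigma_rv Z (Z @^-1` B).
Proof. by move=> mB; exists B => //; rewrite setTI. Qed.

(** Equipping [T] with the generated sigma-algebra as its measurable structure reduces the claim to
    measurability of a sum. *)
Lemma sigma_rvec_linear_form m (Y : 'I_m -> T -> R) (a : 'rV[R]_m) (B : set R) :
  measurable B -> sigma_rvec Y ((fun w => \sum_j a 0 j * Y j w) @^-1` B).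
Proof.
move=> mB; pose G := \bigcup_(j in [set: 'I_m]) sigma_rv (Y j).
have mY j : measurable_fun setT (Y j : g_sigma_algebraType G -> R).
  move=> _ C mC; rewrite setTI; apply: sub_sigma_algebra; exists j => //.
  exact: sigma_rv_preimage.
have : measurable_fun setT ((fun w => \sum_j a 0 j * Y j w) : g_sigma_algebraType G -> R).
  by apply: measurable_sum => j; exact: measurable_funM.
by move=> /(_ measurableT B mB); rewrite setTI.
Qed.

End SigmaAlgebras.

(** * Projections of the sample and their concentration *)

Section Sample.
Context d (T : measurableType d) (R : realType) (P : probability T R).
Variables (n p : nat) (K : R) (Sigma Sh : 'M[R]_p).
Variables (X : 'I_n -> T -> 'cV[R]_p) (Y : 'I_n -> 'I_p -> {RV P >-> R}).
Hypotheses (n_gt0 : (0 < n)%N) (symSh : Sh^T = Sh) (ShSh : Sh *m Sh = Sigma).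
Hypothesis EX : forall i a, ('E_P[fun w => X i w a 0%R] = 0)%E.
Hypothesis covX : forall i a b,
  covariance P (fun w => X i w a 0) (fun w => X i w b 0) = (Sigma a b)%:E.
Hypothesis XE : forall i w, X i w = Sh *m \col_j Y i j w.
Hypothesis indep_rows : independent_sigma P (fun i : 'I_n =>
  sigma_rvec (fun j : 'I_p => Y i j : T -> R)).
Hypothesis indep_coords : forall i, independent_sigma P (fun j => sigma_rv (Y i j)).
Hypothesis EY : forall i j, ('E_P[Y i j] = 0)%E.
Hypothesis psi2Y : forall i j, psi2_norm P (Y i j) = K%:E.

(** Strictly above [K], so that the infimum in [psi2_norm] need not be attained: some admissible
    value lies below [t]. *)
Let t := `|K| + 1.

Definition subgaussian_const : R := 8 * t ^+ 2.

Lemma subgaussian_const_gt0 : 0 < subgaussian_const.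
Proof. by rewrite mulr_gt0// exprn_gt0// ltr_wpDl. Qed.

Lemma psi2_expR_le i j :
  (\int[P]_w (expR (Y i j w ^+ 2 / t ^+ 2))%:E <= 2%:E)%E.
Proof.
have /ereal_inf_lt[_ /= [t' [t'0 ht'] <-]] : (psi2_norm P (Y i j) < t%:E)%E.
  by rewrite psi2Y lte_fin /t (le_lt_trans (ler_norm K))// ltrDl.
rewrite lte_fin => t't; move: ht'; rewrite unlock; apply: le_trans.
have me c : measurable_fun setT (fun w => expR (Y i j w ^+ 2 / c)).
  by apply: measurableT_comp => //; apply: measurable_funM => //; exact: measurable_funX.
apply: ge0_le_integral => //; [exact/measurable_EFinP..|].
move=> w _; rewrite lee_fin ler_expR ler_wpM2l ?sqr_ge0//.
have t0 : 0 < t by exact: lt_trans t't.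
by rewrite lef_pV2 ?posrE ?exprn_gt0// ler_sqr ?nnegrE ?ltW.
Qed.

Let proj (z : 'rV[R]_p) i w := (z *m X i w) 0 0.

Lemma projE z i w : proj z i w = \sum_j (z *m Sh) 0 j * Y i j w.
Proof.
by rewrite /proj XE mulmxA mxE; apply: eq_bigr => j _; rewrite [X in _ * X]mxE.
Qed.

Lemma measurable_proj z i : measurable_fun setT (proj z i).
Proof.
rewrite (_ : proj z i = fun w => \sum_j (z *m Sh) 0 j * Y i j w); last first.
  by apply/funext => w; exact: projE.
by apply: measurable_sum => j; exact: measurable_funM.
Qed.

Lemma bform_cov z : bform Sigma z z = norm2 (z *m Sh) ^+ 2.
Proof. by rewrite sqr_norm2 -ShSh -{2}symSh -{1}[Sh]mulmx1 bform_mul bform1. Qed.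

Lemma mgf_proj z i mu : (\int[P]_w (expR (mu * proj z i w))%:E <=
  (expR (subgaussian_const * bform Sigma z z * mu ^+ 2))%:E)%E.
Proof.
rewrite bform_cov; under eq_integral do rewrite projE.
apply: mgf_linear_form.
- by rewrite /t ltr_wpDl.
- by [].
- apply: (independent_sigma_product_rule (@indep_coords i)) => j B mB.
  exact: sigma_rv_preimage.
- exact: psi2_expR_le.
- by move=> j; have := EY i j; rewrite unlock.
Qed.

Lemma product_rule_proj z : product_rule P (proj z).
Proof.
apply: (independent_sigma_product_rule indep_rows) => i B mB.
rewrite (_ : proj z i = fun w => \sum_j (z *m Sh) 0 j * Y i j w); last first.
  by apply/funext => w; exact: projE.
exact: sigma_rvec_linear_form.
Qed.

Lemma proj_delta a i w : proj (delta_mx 0 a) i w = X i w a 0.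
Proof. by rewrite /proj -rowE mxE. Qed.

Lemma integrable_coord_sqr i a : P.-integrable setT (fun w => (X i w a 0 ^+ 2)%:E).
Proof.
pose e : 'rV[R]_p := delta_mx 0 a.
(* The summand 1 keeps [V] positive when the coordinate has zero variance. *)
pose V := subgaussian_const * (bform Sigma e e + 1).
have b0 : 0 <= bform Sigma e e by rewrite bform_cov sqr_ge0.
have V0 : 0 < V by rewrite mulr_gt0 ?subgaussian_const_gt0// ltr_wpDl.
have mgf mu : (\int[P]_w (expR (mu * proj e i w))%:E <= (expR (V * mu ^+ 2))%:E)%E.
  apply: (le_trans (mgf_proj e i mu)); rewrite lee_fin ler_expR ler_wpM2r ?sqr_ge0//.
  by rewrite ler_wpM2l ?lerDl// ltW// subgaussian_const_gt0.
have V8 : 0 < 8 * V by lra.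
have h := integral_expR_sqr (measurable_proj e i) V0 mgf.
have m2 : measurable_fun setT (fun w => proj e i w ^+ 2).
  by apply: measurable_funX; exact: measurable_proj.
have mG : measurable_fun setT (fun w => expR ((8 * V)^-1 * proj e i w ^+ 2)).
  by apply: measurableT_comp => //; exact: measurable_funM.
have intG : P.-integrable setT (fun w => (expR ((8 * V)^-1 * proj e i w ^+ 2))%:E).
  apply/integrableP; split; first exact/measurable_EFinP.
  under eq_integral do rewrite /= ger0_norm ?expR_ge0//.
  by rewrite (le_lt_trans h)// ltry.
apply: le_integrable (integrableZl measurableT (8 * V) intG) => //.
  apply/measurable_EFinP; under eq_fun do rewrite -proj_delta; exact: m2.
move=> w _; rewrite -EFinM /= lee_fin -proj_delta -/e.
rewrite ger0_norm ?sqr_ge0// ger0_norm; last by rewrite mulr_ge0 ?expR_ge0// ltW.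
rewrite -ler_pdivrMl//.
by apply: le_trans (expR_ge1Dx _); rewrite lerDr.
Qed.

Lemma integrable_coord_mul i a b : P.-integrable setT (fun w => (X i w a 0 * X i w b 0)%:E).
Proof.
have mX c : measurable_fun setT (fun w => X i w c 0).
  by under eq_fun do rewrite -proj_delta; exact: measurable_proj.
have := integrableD measurableT (integrable_coord_sqr i a) (integrable_coord_sqr i b).
apply: le_integrable => //; first by apply/measurable_EFinP; exact: measurable_funM.
move=> w _; rewrite /= lee_fin [leRHS]ger0_norm ?addr_ge0 ?sqr_ge0//.
rewrite ler_norml; apply/andP.
have := sqr_ge0 (X i w a 0 + X i w b 0); have := sqr_ge0 (X i w a 0 - X i w b 0).
have := sqr_ge0 (X i w a 0); have := sqr_ge0 (X i w b 0).
by split; nra.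
Qed.

Lemma integral_coord_mul i a b :
  (\int[P]_w (X i w a 0 * X i w b 0)%:E = (Sigma a b)%:E)%E.
Proof.
rewrite -(covX i a b) covariance.unlock !EX expectation.unlock.
by apply: eq_integral => w _ /=; rewrite [in RHS]/GRing.mul/= !subr0.
Qed.

Lemma integral_proj_sqr z i : (\int[P]_w (proj z i w ^+ 2)%:E = (bform Sigma z z)%:E)%E.
Proof.
transitivity (\int[P]_w (\sum_a \sum_b ((z 0 a * z 0 b)%:E * (X i w a 0 * X i w b 0)%:E)))%E.
  apply: eq_integral => w _; rewrite /proj mxE expr2 mulr_suml -sumEFin.
  apply: eq_bigr => a _; rewrite mulr_sumr -sumEFin; apply: eq_bigr => b _.
  by rewrite -EFinM; congr EFin; ring.
have intab a b : P.-integrable setT (fun w => ((z 0 a * z 0 b)%:E * (X i w a 0 * X i w b 0)%:E)%E).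
  by apply: integrableZl => //; exact: integrable_coord_mul.
rewrite integral_sum//; last by move=> a; exact: integrable_sum.
rewrite /bform !mxE -sumEFin; under eq_bigr do rewrite integral_sum//.
under eq_bigr do under eq_bigr do
  rewrite integralZl ?integrable_coord_mul// integral_coord_mul -EFinM.
under eq_bigr do rewrite sumEFin; rewrite !sumEFin; congr EFin.
under [RHS]eq_bigr do rewrite !mxE mulr_suml.
rewrite exchange_big/=; apply: eq_bigr => b _; apply: eq_bigr => a _.
by ring.
Qed.

Lemma bform_sample_covariance z w :
  n%:R * bform (sample_covariance (fun i => X i w) - Sigma) z z =
  \sum_(i < n) (proj z i w ^+ 2 - bform Sigma z z).
Proof.
have n0 : n%:R != 0 :> R by rewrite pnatr_eq0 -lt0n.
rewrite sumrB sumr_const card_ord bformD bformN mulrBr -[RHS]/(_ - _).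
congr (_ - _); last by rewrite mulr_natl.
rewrite /sample_covariance bform_dotl -scalemxAr dotvZl mulrA mulfV// mul1r.
rewrite mulmx_sumr /dotv mulmx_suml summxE; apply: eq_bigr => i _.
have -> : z *m (X i w *m (X i w)^T) *m z^T = (z *m X i w) *m (z *m X i w)^T.
  by rewrite trmx_mul !mulmxA.
by rewrite mxE big_ord1 [X in _ * X]mxE expr2.
Qed.

Lemma concentration_event (I : finType) (z : I -> 'rV[R]_p) (l1 u : R) :
  0 < l1 -> (forall x, bform Sigma x x <= l1 * norm2 x ^+ 2) -> 0 <= u <= 1 ->
  exists G : set T, [/\ measurable G,
    ((1 - #|I|%:R * (2 * expR (- (n%:R * u ^+ 2 / (4 * rate_const R)))))%:E <= P G)%E &
    forall w, G w -> forall i,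
      `|bform (sample_covariance (fun i => X i w) - Sigma) (z i) (z i)| <=
        u * (subgaussian_const * l1) * norm2 (z i) ^+ 2].
Proof.
move=> l10 hl1 hu; set e := 2 * expR _.
(* The Chernoff bound needs a positive variance proxy, hence the separate case; at a zero vector the
   final inequality is trivial. *)
pose bad i := if z i == 0 then set0 else
  [set w | n%:R * u * (subgaussian_const * l1 * norm2 (z i) ^+ 2) <
    `|\sum_(k < n) (proj (z i) k w ^+ 2 - bform Sigma (z i) (z i))|].
have e0 : 0 <= e by rewrite mulr_ge0 ?expR_ge0.
have sg0 := subgaussian_const_gt0.
have hbad i : measurable (bad i) /\ (P (bad i) <= e%:E)%E.
  rewrite /bad; case: eqP => [_|/eqP z0].
    by split=> //; rewrite measure0 lee_fin.
  have V0 : 0 < subgaussian_const * l1 * norm2 (z i) ^+ 2.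
    by apply: mulr_gt0; [exact: mulr_gt0|rewrite exprn_gt0// norm2_gt0].
  apply: chernoff_two_sided => //.
  - by move=> k; exact: measurable_proj.
  - move=> k mu; apply: (le_trans (mgf_proj _ _ _)).
    by rewrite lee_fin ler_expR ler_wpM2r ?sqr_ge0// -mulrA ler_wpM2l// ltW.
  - by move=> k; exact: integral_proj_sqr.
  - exact: product_rule_proj.
pose B := \big[setU/set0]_(i : I) bad i.
have mB : measurable B by apply: bigsetU_measurable => i _; case: (hbad i).
exists (~` B); split; first exact: measurableC.
  have PB : (P B <= (#|I|%:R * e)%:E)%E.
    rewrite mulr_natl -sumr_const -sumEFin /B.
    suff [] : measurable (\big[setU/set0]_(i : I) bad i) /\
      (P (\big[setU/set0]_(i : I) bad i) <= \sum_(i : I) e%:E)%E by [].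
    elim/big_ind2: _ => [|A1 x1 A2 x2 [m1 h1] [m2 h2]|i _].
    - by rewrite measure0.
    - split; first exact: measurableU.
      by apply: (le_trans (measureU2 _ m1 m2)); exact: leeD.
    - exact: hbad.
  rewrite probability_setC// EFinB leeB//.
move=> w Bw i; have nbad : ~ bad i w.
  by move=> bi; apply: Bw; rewrite /B (bigD1 i)//=; left.
have n0 : 0 < n%:R :> R by rewrite ltr0n.
have [z0|z0] := eqVneq (z i) 0.
  by rewrite z0 norm20 expr0n mulr0 /bform !mul0mx mxE normr0.
rewrite -(ler_pM2l n0) -[X in X * `|_|]gtr0_norm// -normrM bform_sample_covariance.
move: nbad; rewrite /bad (negPf z0) /= => /negP; rewrite -leNgt.
by move=> /le_trans; apply; rewrite !mulrA.
Qed.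

End Sample.

(** * Recovery *)

Lemma with_prob_geI d (T : measurableType d) (R : realType) (P : probability T R)
    (q b : R) (A B : set T) : with_prob_ge P q A -> measurable B ->
  ((1 - b)%:E <= P B)%E -> with_prob_ge P (q - b) (A `&` B).
Proof.
move=> [E [mE EA qE]] mB hB; exists (E `&` B); split; first exact: measurableI.
  by move=> w [Ew Bw]; split=> //; exact: EA.
have mEB : measurable (E `&` B) by exact: measurableI.
have mCB : measurable (~` B) by exact: measurableC.
have h : (P E <= P (E `&` B) + P (~` B))%E.
  apply: (@le_trans _ _ (P ((E `&` B) `|` ~` B))).
    apply: le_measure; rewrite ?inE//; first exact: measurableU.
    by move=> w Ew; have [Bw|Bw] := pselect (B w); [left|right].
  exact: measureU2.
have hC : (P (~` B) <= b%:E)%E.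
  rewrite probability_setC//.
  have fB : P B \is a fin_num by exact: fin_num_measure.
  rewrite -(fineK fB) -EFinB lee_fin; move: hB; rewrite -(fineK fB) lee_fin; lra.
have fEB : P (E `&` B) \is a fin_num by exact: fin_num_measure.
move: (le_trans qE (le_trans h (leeD2l _ hC))).
by rewrite -(fineK fEB) -EFinD !lee_fin; lra.
Qed.

(** * Cardinalities against negative powers of [p] *)

Section PowerBounds.
Variable R : realType.

Lemma expRN_ln_nat (a p : nat) : (0 < p)%N ->
  expR (- (a%:R * ln (p%:R : R))) = (p%:R ^+ a)^-1.
Proof. by move=> p0; rewrite expRN expRM_natl lnK// posrE ltr0n. Qed.

(** For [m > 0], [8 m + 1 <= 9 m <= p^2], so the grid has at most [p ^ (2 s)] points. Against
    [p ^ (- 6 s)] this leaves [2 p ^ (- 4)], and [4 <= p^2]. *)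
Lemma grid_union_bound (m s p : nat) : (m <= s)%N -> (m <= p)%N -> (0 < s)%N ->
  (9 <= p)%N ->
  ((8 * m).+1 ^ m)%:R * (2 * expR (- ((6 * s)%:R * ln (p%:R : R)))) <=
    p%:R ^- 2 / 2.
Proof.
move=> ms mp s0 p9; have p0 : (0 < p)%N by lia.
have pR : 0 < p%:R :> R by rewrite ltr0n.
rewrite expRN_ln_nat//.
have card : ((8 * m).+1 ^ m <= p ^ (2 * s))%N.
  rewrite expnM; apply: (@leq_trans ((p ^ 2) ^ m)).
    have [->|m0] := posnP m; first by rewrite !expn0.
    by rewrite leq_exp2r// expnS expn1; nia.
  by rewrite leq_pexp2l// expn_gt0 p0.
apply: (@le_trans _ _ (p%:R ^+ (2 * s) * (2 * (p%:R ^+ (6 * s))^-1))).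
  by rewrite ler_wpM2r ?mulr_ge0 ?invr_ge0 ?exprn_ge0// -natrX ler_nat.
have -> : p%:R ^+ (2 * s) * (2 * (p%:R ^+ (6 * s))^-1) = 2 * (p%:R ^+ (4 * s))^-1 :> R.
  have -> : (6 * s = 2 * s + 4 * s)%N by lia.
  by rewrite exprD; field; rewrite !expf_neq0 ?gt_eqF.
have : p%:R ^+ 4 <= p%:R ^+ (4 * s) :> R.
  by rewrite ler_weXn2l ?ler1n//; lia.
move=> h; apply: (@le_trans _ _ (2 * (p%:R ^+ 4)^-1)).
  by rewrite ler_wpM2l// lef_pV2 ?posrE ?exprn_gt0.
have -> : 2 * (p%:R ^+ 4)^-1 = p%:R ^- 2 * (2 / p%:R ^+ 2) :> R.
  by field; rewrite gt_eqF.
rewrite ler_wpM2l ?invr_ge0 ?exprn_ge0 ?ler0n// ler_pdivrMr ?exprn_gt0//.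
have : 9%:R <= p%:R :> R by rewrite ler_nat.
by nra.
Qed.

Lemma probe_union_bound (m k p : nat) : (m <= p)%N -> (k <= p)%N -> (9 <= p)%N ->
  (m * k * 2)%:R * (2 * expR (- (6%:R * ln (p%:R : R)))) <= p%:R ^- 2 / 2.
Proof.
move=> mp kp p9; have p0 : (0 < p)%N by lia.
have pR : 0 < p%:R :> R by rewrite ltr0n.
rewrite expRN_ln_nat//.
apply: (@le_trans _ _ ((p%:R * p%:R * 2) * (2 * (p%:R ^+ 6)^-1))).
  rewrite ler_wpM2r ?mulr_ge0 ?invr_ge0 ?exprn_ge0// -!natrM ler_nat.
  by rewrite leq_mul// leq_mul.
have -> : p%:R * p%:R * 2 * (2 * (p%:R ^+ 6)^-1) = p%:R ^- 2 * (4 / p%:R ^+ 2) :> R.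
  by field; rewrite gt_eqF.
rewrite ler_wpM2l ?invr_ge0 ?exprn_ge0 ?ler0n// ler_pdivrMr ?exprn_gt0//.
have : 9%:R <= p%:R :> R by rewrite ler_nat.
by nra.
Qed.

End PowerBounds.

Lemma small_case_bound (R : realDomainType) (a b x y M : R) :
  0 <= a -> 0 <= b -> 0 <= M -> x <= M -> y <= M ->
  a * x + 640 * (b * y) <= (a + 640 * b + 800 * b) * M.
Proof.
move=> a0 b0 M0 xM yM.
have := ler_wpM2l a0 xM; have := ler_wpM2l b0 yM; have := mulr_ge0 b0 M0.
by lra.
Qed.

Lemma large_case_bound (R : realDomainType) (a b z M : R) :
  0 <= a -> 0 <= b -> 0 <= M -> z <= M -> 1 <= 400 * (b * z) ->
  2 <= (a + 640 * b + 800 * b) * M.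
Proof.
move=> a0 b0 M0 zM h.
have := ler_wpM2l b0 zM; have := mulr_ge0 a0 M0; have := mulr_ge0 b0 M0.
by lra.
Qed.

(** * The bound at a fixed sample size *)

Section FixedSampleSize.
Context d (T : measurableType d) (R : realType) (P : probability T R).
Variables (n p s k : nat) (K delta kappa lambda : R).
Variables (Sigma Sh : 'M[R]_p) (lam : seq R) (U : 'M[R]_(p, k)) (J : {set 'I_p}).
Variables (X : 'I_n -> T -> 'cV[R]_p) (Y : 'I_n -> 'I_p -> {RV P >-> R}).
Variables (Jhat : T -> {set 'I_p}) (Ut : T -> 'M[R]_(p, k)).
Hypotheses (n_gt0 : (0 < n)%N) (s_gt0 : (0 < s)%N) (p_ge : (9 <= p)%N).
Hypotheses (k_gt0 : (0 < k)%N) (k_lt : (k < p)%N).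
Hypotheses (psdS : psd Sigma) (eigS : ordered_eigenvalues Sigma lam).
Hypotheses (leadU : leading_eigenvectors Sigma lam U) (J_le : (#|J| <= s)%N).
Hypothesis suppU : forall i, i \notin J -> row i U = 0.
Hypothesis EX : forall i a, ('E_P[fun w => X i w a 0%R] = 0)%E.
Hypothesis covX : forall i a b,
  covariance P (fun w => X i w a 0) (fun w => X i w b 0) = (Sigma a b)%:E.
Hypothesis refitUt : forall w, (k <= #|Jhat w|)%N ->
  refit (sample_covariance (fun i : 'I_n => X i w)) (Jhat w) (Ut w).
Hypothesis sparsistent : with_prob_ge P (1 - delta) [set w | Jhat w = J].
Hypothesis sqrtS : is_psd_sqrt Sh Sigma.
Hypothesis XE : forall i w, X i w = Sh *m \col_j Y i j w.
Hypothesis indep_rows : independent_sigma P (fun i : 'I_n =>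
  sigma_rvec (fun j : 'I_p => Y i j : T -> R)).
Hypothesis indep_coords : forall i, independent_sigma P (fun j => sigma_rv (Y i j)).
Hypothesis EY : forall i j, ('E_P[Y i j] = 0)%E.
Hypothesis psi2Y : forall i j, psi2_norm P (Y i j) = K%:E.
Hypotheses (gap : eigval lam k.+1 <= lambda / 2) (lambda_gt0 : 0 < lambda).
Hypotheses (lambda_le : lambda <= eigval lam k).
Hypotheses (lk_le : eigval lam k <= eigval lam 1).
Hypothesis kappa_ge : eigval lam 1 <= kappa * lambda.

Let A := rate_const R.
Let L := subgaussian_const K.
Let rate : R := s%:R * ln p%:R / n%:R.
Hypothesis rate_le : 24 * A * rate <= 1.

(* The three terms come from the first-order part, from the quadratic remainder,
   and from the trivial bound 2 when [kappa ^+ 2 * rate] is not small. *)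
Definition recovery_const : R :=
  2 * L * Num.sqrt (24 * A) + 640 * (L ^+ 2 * (24 * A)) + 800 * (L ^+ 2 * (24 * A)).

(** The condition on [rate] keeps [u1] and [u2] in [[0, 1]], the range where the Chernoff exponent
    is quadratic. *)
Lemma fixed_recovery : with_prob_ge P (1 - delta - p%:R ^- 2)
  [set w | exists W : 'M[R]_k, orthogonal_mx W /\
     norm2inf (Ut w - U *m W) <= recovery_const *
       (kappa ^+ 2 * Num.sqrt (k%:R * ln p%:R / n%:R) + kappa ^+ 3 * rate)].
Proof.
have A512 : 512 <= A := rate_const_ge R.
have L0 : 0 < L := subgaussian_const_gt0 K.
have n0 : 0 < n%:R :> R by rewrite ltr0n.
have s1 : 1 <= s%:R :> R by rewrite ler1n.
have p0 : (0 < p)%N by exact: leq_trans p_ge.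
have lnp0 : 0 <= ln p%:R :> R by rewrite ln_ge0// ler1n.
have lk0 : 0 < eigval lam k by exact: lt_le_trans lambda_le.
have l10 : 0 < eigval lam 1 by exact: lt_le_trans lk_le.
have kl : eigval lam 1 / eigval lam k <= kappa.
  have k0 : 0 <= kappa.
    by rewrite -(pmulr_lge0 _ lambda_gt0) (le_trans _ kappa_ge)// ltW.
  by rewrite ler_pdivrMr// (le_trans kappa_ge)// ler_wpM2l.
have kappa1 : 1 <= kappa by apply: le_trans kl; rewrite ler_pdivlMr// mul1r.
have gap' : eigval lam k.+1 <= eigval lam k / 2.
  by apply: (le_trans gap); rewrite ler_wpM2r.
have [[symSh psdSh] ShSh] := sqrtS.
have [symS _] := psdS; have [UU eigU] := leadU.
have rate0 : 0 <= rate by rewrite /rate divr_ge0 ?mulr_ge0 ?ler0n.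
(* The exponent [n u^2 / (4 A)] becomes [6 s ln p] for [u1] and [6 ln p] for [u2], as the two union
   bounds require. *)
pose u1 := Num.sqrt (24 * A * rate).
pose u2 : R := Num.sqrt (24 * A * (ln p%:R / n%:R)).
have rate2 : 0 <= ln (p%:R : R) / n%:R <= rate.
  apply/andP; split; first by rewrite divr_ge0.
  by rewrite /rate ler_wpM2r ?invr_ge0 ?ler0n// ler_peMl.
have A0 : 0 <= 24 * A by lra.
have u1sq : u1 ^+ 2 = 24 * A * rate by rewrite sqr_sqrtr// mulr_ge0.
have u2sq : u2 ^+ 2 = 24 * A * (ln p%:R / n%:R) :> R.
  by rewrite sqr_sqrtr// mulr_ge0//; case/andP: rate2.
have u1_01 : 0 <= u1 <= 1.
  by rewrite sqrtr_ge0/= -sqrtr1 ler_sqrt.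
have u2_01 : 0 <= u2 <= 1.
  rewrite sqrtr_ge0/= -sqrtr1 ler_sqrt// (le_trans _ rate_le)// ler_wpM2l//.
  by case/andP: rate2.
have upper := spectral_upper psdS eigS.
have [G1 [mG1 PG1 hG1]] := concentration_event n_gt0 symSh ShSh EX covX XE
  indep_rows indep_coords EY psi2Y
  (fun f : {ffun 'I_#|J| -> 'I_(8 * #|J|).+1} => grid_row R f *m selmx R J) l10 upper u1_01.
have [G2 [mG2 PG2 hG2]] := concentration_event n_gt0 symSh ShSh EX covX XE
  indep_rows indep_coords EY psi2Y (probe Sigma lam U (J := J)) l10 upper u2_01.
(* [refit] is available only for supports of size at least [k]; the restriction of [U] to [J] still
   has [k] orthonormal columns. *)
have kJ : (k <= #|J|)%N.
  apply: (@ortho_cols_leq R _ _ (selmx R J *m U)).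
  by rewrite trmx_mul -mulmxA (selmx_supported suppU).
have mJp : (#|J| <= p)%N by rewrite -[leqRHS]card_ord max_card.
have AA0 : A != 0 by rewrite gt_eqF//; lra.
have nn0 : n%:R != 0 :> R by rewrite gt_eqF.
have {}PG1 : ((1 - p%:R ^- 2 / 2)%:E <= P G1)%E.
  apply: le_trans PG1; rewrite lee_fin lerD2l lerN2 card_ffun !card_ord.
  apply: le_trans (grid_union_bound R J_le mJp s_gt0 p_ge).
  rewrite ler_wpM2l ?ler0n// ler_wpM2l// ler_expR u1sq /rate natrM -/A.
  rewrite le_eqVlt; apply/orP; left; apply/eqP; field.
  by rewrite ?AA0 ?nn0.
have {}PG2 : ((1 - p%:R ^- 2 / 2)%:E <= P G2)%E.
  apply: le_trans PG2; rewrite lee_fin lerD2l lerN2 !card_prod !card_ord card_bool.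
  apply: le_trans (probe_union_bound R mJp (ltnW k_lt) p_ge).
  rewrite ler_wpM2l ?ler0n// ler_wpM2l// ler_expR u2sq -/A.
  rewrite le_eqVlt; apply/orP; left; apply/eqP; field.
  by rewrite ?AA0 ?nn0.
have [E [mE EA PE]] := with_prob_geI (with_prob_geI sparsistent mG1 PG1) mG2 PG2.
exists E; split=> //; last first.
  by apply: le_trans PE; rewrite lee_fin; lra.
move=> w /EA[[/= JJ Gw1] Gw2].
have hr := @refitUt w; rewrite JJ in hr; have {}hr := hr kJ.
set Shat := sample_covariance _ in hr.
have symSh' : Shat^T = Shat.
  rewrite /Shat /sample_covariance linearZ/= linear_sum/=; congr (_ *: _).
  by apply: eq_bigr => i _; rewrite trmx_mul trmxK.
have k23 : kappa ^+ 2 <= kappa ^+ 3 by rewrite ler_weXn2l.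
have k12 : kappa <= kappa ^+ 2 by rewrite -[leLHS]expr1 ler_weXn2l.
have sq0 : 0 <= Num.sqrt (k%:R * ln p%:R / n%:R) :> R by exact: sqrtr_ge0.
have [small|large] := leP (u1 * (L * eigval lam 1) * 4) (eigval lam k / 5).
  have hq : 4 * (u1 * (L * eigval lam 1)) <= eigval lam k / 5 by rewrite mulrC.
  have q0 : 0 <= u1 * (L * eigval lam 1).
    by rewrite mulr_ge0 ?sqrtr_ge0// mulr_ge0// ltW.
  have q'0 : 0 <= u2 * (L * eigval lam 1).
    by rewrite mulr_ge0 ?sqrtr_ge0// mulr_ge0// ltW.
  have [W [oW hW]] := refit_recovery psdS eigS k_gt0 k_lt leadU suppU lk0 gap'
    symSh' hr q0 q'0 hq (hG1 w Gw1) (hG2 w Gw2).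
  exists W; split=> //; apply: (le_trans hW).
  set r := eigval lam 1 / eigval lam k in kl.
  have r0 : 0 <= r by rewrite divr_ge0// ltW.
  have r2 : r ^+ 2 <= kappa ^+ 2 by rewrite ler_sqr ?nnegrE// (le_trans _ kappa1).
  have -> : Num.sqrt k%:R * (2 * (u2 * (L * eigval lam 1)) / eigval lam k) =
      2 * L * Num.sqrt (24 * A) * (r * Num.sqrt (k%:R * ln p%:R / n%:R)).
    have -> : Num.sqrt (k%:R * ln p%:R / n%:R) =
        Num.sqrt k%:R * Num.sqrt (ln p%:R / n%:R) :> R.
      by rewrite -mulrA sqrtrM ?ler0n.
    have -> : u2 = Num.sqrt (24 * A) * Num.sqrt (ln p%:R / n%:R) by rewrite /u2 sqrtrM.
    by rewrite /r; field; rewrite gt_eqF.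
  have -> : 40 * (4 * (u1 * (L * eigval lam 1)) / eigval lam k) ^+ 2 =
      640 * (L ^+ 2 * (24 * A) * (r ^+ 2 * rate)).
    transitivity (640 * L ^+ 2 * r ^+ 2 * u1 ^+ 2).
      by rewrite /r; field; rewrite gt_eqF.
    by rewrite u1sq; ring.
  set sq := Num.sqrt (_ / n%:R) in sq0 *.
  have c1 : 0 <= 2 * L * Num.sqrt (24 * A) by rewrite mulr_ge0 ?sqrtr_ge0// mulr_ge0// ltW.
  have c2 : 0 <= L ^+ 2 * (24 * A) by rewrite mulr_ge0 ?sqr_ge0.
  have t1 : r * sq <= kappa ^+ 2 * sq + kappa ^+ 3 * rate.
    rewrite (@le_trans _ _ (kappa ^+ 2 * sq))//; first by rewrite ler_wpM2r// (le_trans kl).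
    by rewrite lerDl mulr_ge0// exprn_ge0// (le_trans _ kappa1).
  have t2 : r ^+ 2 * rate <= kappa ^+ 2 * sq + kappa ^+ 3 * rate.
    rewrite (@le_trans _ _ (kappa ^+ 3 * rate))//; first by rewrite ler_wpM2r// (le_trans r2).
    by rewrite lerDr mulr_ge0// sqr_ge0.
  have t0 : 0 <= kappa ^+ 2 * sq + kappa ^+ 3 * rate by rewrite (le_trans _ t1)// mulr_ge0.
  exact: small_case_bound.
exists 1%:M; split; first by split; rewrite trmx1 mulmx1.
rewrite mulmx1; apply: (@le_trans _ _ 2).
  have rowU i : norm2 (row i U) <= 1 by apply: opbound_row; exact: opbound_ortho.
  have rowUt i : norm2 (row i (Ut w)) <= 1.
    have [[l [V [_ [VV _] rV]]] Ut0] := hr.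
    have [iJ|iJ] := boolP (i \in J); last by rewrite Ut0// norm20.
    rewrite -(enum_rankK_in iJ iJ) rV; apply: opbound_row; exact: opbound_ortho.
  apply: norm2inf_le => // i.
  rewrite (_ : row i (Ut w - U) = row i (Ut w) - row i U); last exact: raddfB.
  by apply: (le_trans (ler_norm2B _ _)); have := rowU i; have := rowUt i; lra.
(* Failure of the smallness condition gives [1 <= 20 L u1 kappa]; the 400 appears on squaring, and
   the trivial bound 2 doubles it to 800. *)
have big : 1 <= 400 * (L ^+ 2 * (24 * A) * (kappa ^+ 2 * rate)).
  have g : 1 <= 20 * L * u1 * (eigval lam 1 / eigval lam k).
    by rewrite mulrA ler_pdivlMr// mul1r; move: large; lra.
  have Lu : 0 <= 20 * L * u1 by rewrite mulr_ge0 ?sqrtr_ge0// mulr_ge0// ltW.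
  have {}g : 1 <= 20 * L * u1 * kappa by apply: (le_trans g); rewrite ler_wpM2l.
  apply: (le_trans (exprn_ege1 2 g)); rewrite !exprMn u1sq.
  by rewrite le_eqVlt; apply/orP; left; apply/eqP; ring.
have k3 : kappa ^+ 2 * rate <= kappa ^+ 3 * rate by rewrite ler_wpM2r.
set sq := Num.sqrt (_ / n%:R) in sq0 *.
have c1 : 0 <= 2 * L * Num.sqrt (24 * A) by rewrite mulr_ge0 ?sqrtr_ge0// mulr_ge0// ltW.
have c2 : 0 <= L ^+ 2 * (24 * A) by rewrite mulr_ge0 ?sqr_ge0.
have t2 : kappa ^+ 2 * rate <= kappa ^+ 2 * sq + kappa ^+ 3 * rate.
  by rewrite (le_trans k3)// lerDr mulr_ge0// sqr_ge0.
have t0 : 0 <= kappa ^+ 2 * sq + kappa ^+ 3 * rate.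
  by apply: le_trans t2; rewrite mulr_ge0// sqr_ge0.
exact: large_case_bound big.
Qed.

End FixedSampleSize.

Lemma with_prob_ge_sub d (T : measurableType d) (R : realType)
    (P : probability T R) (q : R) (A B : set T) :
  A `<=` B -> with_prob_ge P q A -> with_prob_ge P q B.
Proof. by move=> AB [E [mE EA qE]]; exists E; split=> // w /EA /AB. Qed.

Theorem theorem1 (R : realType)
  (* common subgaussian norm of the coordinates Y_ij; 1 in the normalization
     of hypothesis (3) *)
  (K : R) :
  exists C0 : R, forall C : R, C0 <= C ->
  forall (d : nat -> measure_display) (T : forall n, measurableType (d n))
    (P : forall n, probability (T n) R)
    (p s k : nat -> nat) (delta kappa lambda : nat -> R) (eps : R)
    (Sigma Sigma_half : forall n, 'M[R]_(p n)) (lam : nat -> seq R)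
    (U : forall n, 'M[R]_(p n, k n)) (J : forall n, {set 'I_(p n)})
    (X : forall n, 'I_n -> T n -> 'cV[R]_(p n))
    (Y : forall n, 'I_n -> 'I_(p n) -> {RV (P n) >-> R})
    (* the algorithm may use internal randomness carried by the sample space *)
    (alg : forall n, 'M[R]_(p n) -> T n -> {set 'I_(p n)})
    (Jhat : forall n, T n -> {set 'I_(p n)})
    (Utilde : forall n, T n -> 'M[R]_(p n, k n)),
  (* setting *)
  (forall n, (0 < n)%N -> [/\ (0 < p n)%N, (0 < s n)%N & (0 < k n < p n)%N]) ->
  (forall n, (0 < n)%N -> psd (Sigma n)) ->
  (forall n, (0 < n)%N -> ordered_eigenvalues (Sigma n) (lam n)) ->
  (forall n, (0 < n)%N ->
     eigval (lam n) (k n).+1 < eigval (lam n) (k n)) ->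
  (forall n, (0 < n)%N -> leading_eigenvectors (Sigma n) (lam n) (U n)) ->
  (forall n, (0 < n)%N ->
     (#|J n| <= s n)%N /\ forall i, i \notin J n -> row i (U n) = 0) ->
  (forall n (i : 'I_n) (a : 'I_(p n)),
     ('E_(P n)[fun w => X n i w a 0%R] = 0)%E) ->
  (forall n (i : 'I_n) (a b : 'I_(p n)),
     covariance (P n) (fun w => X n i w a 0) (fun w => X n i w b 0)
       = (Sigma n a b)%:E) ->
  (* procedure *)
  (forall n (w : T n), (0 < n)%N ->
     Jhat n w = alg n (sample_covariance (fun i : 'I_n => X n i w)) w) ->
  (forall n (w : T n), (0 < n)%N -> (k n <= #|Jhat n w|)%N ->
     refit (sample_covariance (fun i : 'I_n => X n i w)) (Jhat n w)
       (Utilde n w)) ->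
  (* (1) *)
  much_less (fun n => (s n)%:R * ln (p n)%:R) (fun n => n%:R : R) ->
  much_less (fun n => (k n)%:R : R) (fun n => (s n)%:R) ->
  lesssim (fun n => n%:R : R) (fun n => (p n)%:R) ->
  (* (2) *)
  (\forall n \near \oo,
     with_prob_ge (P n) (1 - delta n) [set w | Jhat n w = J n]) ->
  (* (3) *)
  (forall n, (0 < n)%N -> is_psd_sqrt (Sigma_half n) (Sigma n)) ->
  (forall n (i : 'I_n) (w : T n),
     X n i w = Sigma_half n *m \col_(j < p n) Y n i j w) ->
  (forall n, independent_sigma (P n) (fun i : 'I_n =>
     sigma_rvec (fun j : 'I_(p n) => Y n i j : T n -> R))) ->
  (forall n (i : 'I_n), independent_sigma (P n) (fun j : 'I_(p n) =>
     sigma_rv (Y n i j))) ->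
  (forall n (i : 'I_n) (j : 'I_(p n)), ('E_(P n)[Y n i j] = 0)%E) ->
  (forall n (i : 'I_n) (j : 'I_(p n)), ('V_(P n)[Y n i j] = 1)%E) ->
  (forall n (i : 'I_n) (j : 'I_(p n)), psi2_norm (P n) (Y n i j) = K%:E) ->
  (* (4) *)
  (\forall n \near \oo,
     C * eigval (lam n) 1 *
         (Num.sqrt ((s n)%:R / n%:R) + Num.sqrt (ln (p n)%:R / n%:R))
       + eigval (lam n) (k n).+1 / 8%:R <= eigval (lam n) (k n) / 8%:R) ->
  64%:R^-1 < eps ->
  (forall n, (0 < n)%N ->
     2%:R * eigval (lam n) (k n).+1 < (1 - eps) * eigval (lam n) (k n)) ->
  (* (5) *)
  lesssim (fun n => norm2inf (U n))
          (fun n => Num.sqrt ((k n)%:R / (s n)%:R)) ->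
  lesssim (fun n => (k n)%:R : R) (fun n => Num.sqrt (s n)%:R) ->
  (\forall n \near \oo,
     [/\ eigval (lam n) (k n).+1 <= lambda n / 2%:R,
         lambda n / 2%:R < lambda n,
         lambda n <= eigval (lam n) (k n),
         eigval (lam n) (k n) <= eigval (lam n) 1 &
         eigval (lam n) 1 <= kappa n * lambda n]) ->
  rowwise_recovery P (fun n => 1 - delta n - (p n)%:R ^- 2)
    (fun n => kappa n ^+ 2 * Num.sqrt ((k n)%:R * ln (p n)%:R / n%:R)
            + kappa n ^+ 3 * ((s n)%:R * ln (p n)%:R / n%:R))
    U Utilde
  /\
  (lesssim kappa (fun=> 1) ->
   rowwise_recovery P (fun n => 1 - delta n - (p n)%:R ^- 2)
    (fun n => Num.sqrt ((k n)%:R * ln (p n)%:R / n%:R)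
            + (s n)%:R * ln (p n)%:R / n%:R)
    U Utilde).
Proof.
exists 0 => C _ d T P p s k delta kappa lambda eps Sigma Sh lam U J X Y alg Jhat Ut.
move=> Hdim Hpsd Heig _ Hlead HJ HEX Hcov _ Hrefit Hrate _ Hnp Hsparse Hsqrt HXE.
move=> Hrows Hcoords HEY _ Hpsi _ _ _ _ _ Hlam.
have A512 := rate_const_ge R.
pose Cst := recovery_const K.
have Cst0 : 0 <= Cst.
  have L0 := subgaussian_const_gt0 K.
  have A0 : 0 <= 24 * rate_const R by lra.
  have q0 : 0 <= subgaussian_const K ^+ 2 * (24 * rate_const R).
    by rewrite mulr_ge0 ?sqr_ge0.
  have q1 : 0 <= 2 * subgaussian_const K * Num.sqrt (24 * rate_const R).
    by rewrite mulr_ge0 ?sqrtr_ge0// mulr_ge0// ltW.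
  by rewrite /Cst /recovery_const; move: q0 q1; lra.
have Hn : \forall n \near \oo, (0 < n)%N by exact: nbhs_infty_gt.
(* From [n <= c p] once [n > 9 |c|]. *)
have Hp : \forall n \near \oo, (9 <= p n)%N.
  have [c hc] := Hnp; near=> n.
  have np : n%:R <= c * (p n)%:R by near: n.
  have n0 : (0 < n)%N by near: n.
  have nc : 9 * `|c| < n%:R by near: n; exact: nbhs_infty_gtr.
  have : 9 * `|c| < `|c| * (p n)%:R.
    by apply: (lt_le_trans nc); apply: (le_trans np); rewrite ler_wpM2r ?ler_norm.
  rewrite mulrC; have := normr_ge0 c; rewrite le_eqVlt => /orP[/eqP <-|c0].
    by rewrite !mul0r ltxx.
  by rewrite ltr_pM2l// ltr_nat => /ltnW.
have Hrate' : \forall n \near \oo,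
    24 * rate_const R * ((s n)%:R * ln (p n)%:R / n%:R) <= 1.
  have e0 : 0 < (24 * rate_const R)^-1 by rewrite invr_gt0; lra.
  have h : \forall n \near \oo,
      `|(s n)%:R * ln (p n)%:R / n%:R| <= (24 * rate_const R)^-1.
    exact: cvgr0_norm_le Hrate _ e0.
  apply: filterS h => n hn.
  rewrite -ler_pdivlMl; last by lra.
  by rewrite mulr1; exact: le_trans (ler_norm _) hn.
have core : \forall n \near \oo, 1 <= kappa n /\ with_prob_ge (P n)
    (1 - delta n - (p n)%:R ^- 2)
    [set w | exists W : 'M[R]_(k n), orthogonal_mx W /\
       norm2inf (Ut n w - U n *m W) <= Cst *
       (kappa n ^+ 2 * Num.sqrt ((k n)%:R * ln (p n)%:R / n%:R)
            + kappa n ^+ 3 * ((s n)%:R * ln (p n)%:R / n%:R))].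
  near=> n.
  have n0 : (0 < n)%N by near: n.
  have pn : (9 <= p n)%N by near: n.
  have [p0 s0 /andP[k0 kp]] := Hdim n n0.
  have [Jle Jsupp] := HJ n n0.
  have [h1 h2 h3 h4 h5] : [/\ eigval (lam n) (k n).+1 <= lambda n / 2%:R,
         lambda n / 2%:R < lambda n, lambda n <= eigval (lam n) (k n),
         eigval (lam n) (k n) <= eigval (lam n) 1 &
         eigval (lam n) 1 <= kappa n * lambda n] by near: n.
  (* Positivity of [lambda] is encoded in [lambda / 2 < lambda]. *)
  have l0 : 0 < lambda n by move: h2; lra.
  split.
    rewrite -(ler_pM2r l0) mul1r; apply: (le_trans h3); exact: (le_trans h4).
  apply: (fixed_recovery n0 s0 pn k0 kp (Hpsd n n0) (Heig n n0) (Hlead n n0) Jle Jsupp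
    (HEX n) (Hcov n) _ _ (Hsqrt n n0) (HXE n) (Hrows n) (Hcoords n) (HEY n)
    (Hpsi n) h1 l0 h3 h4 h5).
  - by move=> w; exact: Hrefit.
  - by near: n.
  - by near: n.
split.
  by exists Cst; apply: filterS core => n [].
(* One cube dominates both powers of [kappa], because [1 <= kappa] gives [kappa^2 <= kappa^3];
   [core] records that lower bound for this purpose. *)
move=> [c hc]; exists (Cst * (`|c| + 1) ^+ 3).
near=> n.
have [k1 hn] : 1 <= kappa n /\ with_prob_ge (P n)
    (1 - delta n - (p n)%:R ^- 2)
    [set w | exists W : 'M[R]_(k n), orthogonal_mx W /\
       norm2inf (Ut n w - U n *m W) <= Cst *
       (kappa n ^+ 2 * Num.sqrt ((k n)%:R * ln (p n)%:R / n%:R)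
            + kappa n ^+ 3 * ((s n)%:R * ln (p n)%:R / n%:R))] by near: n.
have kc : kappa n <= c * 1 by near: n; exact: hc.
have p9 : (9 <= p n)%N by near: n.
have k0 : 0 <= kappa n by exact: le_trans k1.
have kM : kappa n <= `|c| + 1 by have := ler_norm c; lra.
apply: with_prob_ge_sub hn => w [W [oW hW]]; exists W; split=> //.
apply: (le_trans hW); rewrite -[leRHS]mulrA ler_wpM2l// mulrDr.
have kM3 : kappa n ^+ 3 <= (`|c| + 1) ^+ 3.
  by rewrite lerXn2r ?nnegrE// addr_ge0.
have k23 : kappa n ^+ 2 <= kappa n ^+ 3 by rewrite ler_weXn2l.
apply: lerD; apply: ler_wpM2r => //.
- exact: le_trans kM3.
- by rewrite divr_ge0// mulr_ge0// ln_ge0// ler1n (leq_trans _ p9).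
Unshelve. all: by end_near. Qed.
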